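(* Let $(L|K,v)$ be a pure defect or a branched pure extension in $\eta$ (where $L=K(\eta)$), and let $B$ be the set of exponents attached to the minimal key polynomials for $\Psi_1$ (with respect to the valuation $\nu$ on $K[x]$ defined by $v$ and $\eta$). Then $$\Omega=(0)\iff 1\in B.$$
   Context: $\mathcal{O}_L,\mathcal{O}_K$ are the valuation rings of $(L,v),(K,v)$, and $\Omega$ is the $\mathcal{O}_L$-module of Kähler differentials of $\mathcal{O}_L|\mathcal{O}_K$. A simple algebraic immediate extension $(L|K,v)$, $L=K(\eta)$ (immediate: $vL=vK$ and $Lv=Kv$), is pure immediate in $\eta$ if for every $f\in K[x]$ with $\deg f<[L:K]$ there is $c\in K$ such that for every $b\in K$: $v(\eta-b)\ge v(\eta-c)\Rightarrow v(f(b))=v(f(c))$. It is unibranched if $v$ is the unique extension of $v|_K$ to $L$. Pure defect (in $\eta$): pure immediate (in $\eta$) and unibranched. Branched pure (in $\eta$): pure immediate (in $\eta$) and not unibranched. Let $\nu(f)=v(f(\eta))$ on $K[x]$, and fix an extension of $\nu$ to $\overline K[x]$. For $f\in K[x]\setminus K$, $\delta(f)=\max\{\nu(x-a)\mid f(a)=0\}$. A monic $Q\in K[x]\setminus K$ is a key polynomial for $\nu$ if $\delta(f)\ge\delta(Q)\Rightarrow\deg f\ge\deg Q$ for all $f\in K[x]\setminus K$. $\Psi_m$ is the set of key polynomials of degree $m$; for a pure extension of degree $n$ it is non-empty only for $m=1$ and $m=n$. A key polynomial for $\Psi_1$ is a key polynomial for $\nu$ whose degree is the smallest degree, among key polynomials,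 strictly larger than $1$. In the present case $\nu(\Psi_1)$ has no maximum; let $\mathbf{Q}_1$ be any well-ordered (with respect to $\nu$) cofinal subset of $\Psi_1$. For $\deg q>0$ write the $q$-expansion of $F$ as $F=F_{r,q}q^r+\ldots+F_{0,q}$ ($\deg F_{\ell,q}<\deg q$). A key polynomial $F$ for $\Psi_1$ is minimal if there exist $Q\in\mathbf{Q}_1$ and $B\subseteq\mathbb{N}$ ($\mathbb N$ = positive integers) such that for every $R\in\mathbf{Q}_1$ with $\nu(R)\ge\nu(Q)$ the polynomial $F_{0,R}+\sum_{\ell\in B}F_{\ell,R}R^\ell$ is a key polynomial for $\Psi_1$, but for every $s\in B$ there is a cofinal subset of $\mathbf{Q}_1$ such that for every $R$ in it $F_{0,R}+\sum_{\ell\in B\setminus\{s\}}F_{\ell,R}R^\ell$ is not a key polynomial for $\Psi_1$. The paper states that $B$ does not depend on $F$ or $Q$. *)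

(* Defs.v *)
From HB Require Import structures.
From mathcomp Require Import all_boot all_order all_algebra all_field.
From mathcomp Require Import generic_quotient ring_quotient.
From mathcomp Require Import boolp classical_sets.
From mathcomp.multinomials Require Import freeg.

Set Implicit Arguments.
Unset Strict Implicit.
Unset Printing Implicit Defensive.

Import Order.TTheory GRing.Theory.

Local Open Scope classical_set_scope.
Local Open Scope ring_scope.

(* Totality is a field, rather than inherited from [Order.Total], because the
   join of [Order.Total] and [GRing.Zmodule] is not in the hierarchy. *)
HB.mixin Record isOrderedAb G of Num.POrderedZmodule G := {
  oab_le_total : total (<=%R : rel G);
  oab_leD2l : forall z x y : G, x <= y -> z + x <= z + y
}.

#[short(type="orderedAbType")]
HB.structure Definition OrderedAb :=
  { G of isOrderedAb G & Num.POrderedZmodule G }.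

(* [vinf G] is G with an absorbing greatest element [Infty] added. *)
Definition vinf (G : Type) := option G.
Definition Fin (G : Type) (g : G) : vinf G := Some g.
Definition Infty (G : Type) : vinf G := None.
Arguments Infty {G}.

HB.instance Definition _ (G : choiceType) := Choice.copy (vinf G) (option G).

Section VInf.
Variable G : orderedAbType.
Implicit Types x y z : vinf G.

Definition vinf_add x y : vinf G :=
  match x, y with Some a, Some b => Fin (a + b) | _, _ => Infty end.

Definition vinf_le x y : bool :=
  match x, y with
  | _, None => true
  | None, Some _ => false
  | Some a, Some b => a <= b
  end.

Definition vinf_lt x y : bool := (y != x) && vinf_le x y.

Lemma vinf_addA : associative vinf_add.
Proof. by move=> [a|] [b|] [c|] //=; rewrite addrA. Qed.

Lemma vinf_addC : commutative vinf_add.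
Proof. by move=> [a|] [b|] //=; rewrite addrC. Qed.

Lemma vinf_add0 : left_id (Fin 0) vinf_add.
Proof. by move=> [a|] //=; rewrite add0r. Qed.

Lemma vinf_le_anti : antisymmetric vinf_le.
Proof. by move=> [a|] [b|] //= /le_anti ->. Qed.

Lemma vinf_le_trans : transitive vinf_le.
Proof. by move=> [a|] [b|] [c|] //=; apply: le_trans. Qed.

Lemma vinf_le_total : total vinf_le.
Proof. by move=> [a|] [b|] //=; apply: oab_le_total. Qed.

HB.instance Definition _ :=
  GRing.isNmodule.Build (vinf G) vinf_addA vinf_addC vinf_add0.

HB.instance Definition _ := Order.isOrder.Build ring_display (vinf G)
  (fun _ _ => erefl) (fun _ _ => erefl) (fun _ _ => erefl)
  vinf_le_anti vinf_le_trans vinf_le_total.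

End VInf.

(* The value group need not be exhausted by the values, and the support
   (the set of elements of value Infty) need not be zero; on a field the
   support is automatically zero. *)
Record valuation (R : comNzRingType) (G : orderedAbType) := Valuation {
  vfun :> R -> vinf G;
  vfun0 : vfun 0 = Infty;
  vfun1 : vfun 1 = Fin 0;
  vfunM : forall x y, vfun (x * y) = vfun x + vfun y;
  vfunD : forall x y, Order.min (vfun x) (vfun y) <= vfun (x + y)
}.

Section VComp.
Variables (R S : comNzRingType) (G : orderedAbType).
Variables (f : {rmorphism R -> S}) (v : valuation S G).

Lemma vcomp0 : (v \o f) 0 = Infty. Proof. by rewrite /= rmorph0 vfun0. Qed.
Lemma vcomp1 : (v \o f) 1 = Fin 0. Proof. by rewrite /= rmorph1 vfun1. Qed.
Lemma vcompM x y : (v \o f) (x * y) = (v \o f) x + (v \o f) y.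
Proof. by rewrite /= rmorphM vfunM. Qed.
Lemma vcompD x y :
  Order.min ((v \o f) x) ((v \o f) y) <= (v \o f) (x + y).
Proof. by rewrite /= rmorphD vfunD. Qed.

Definition vcomp : valuation R G := Valuation vcomp0 vcomp1 vcompM vcompD.

End VComp.

Section ValuationRing.
Variables (R : comNzRingType) (G : orderedAbType) (v : valuation R G).

Definition vring_pred : {pred R} := [pred x | Fin 0 <= v x].

Lemma vfunN1 : v (-1) = Fin 0.
Proof.
have : v (-1) + v (-1) = Fin 0 by rewrite -vfunM mulrNN mulr1 vfun1.
case: (v (-1)) => [a|] //= -[] /= aa0.
congr Some; have aN : a = - a by apply/eqP; rewrite -addr_eq0 aa0.
have /orP[a0|a0] := oab_le_total a 0.
  apply/le_anti; rewrite a0 /=.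
  by have := oab_leD2l (- a) _ _ a0; rewrite addNr addr0 -aN.
apply/le_anti; rewrite a0 andbT.
by have := oab_leD2l (- a) _ _ a0; rewrite addNr addr0 -aN.
Qed.

Lemma vinf_addr_ge0 (x y : vinf G) : Fin 0 <= x -> Fin 0 <= y -> Fin 0 <= x + y.
Proof.
case: x y => [a|] [b|] //= a0 b0.
by apply: le_trans (a0 : 0 <= a) _; rewrite -[leLHS]addr0; apply: oab_leD2l.
Qed.

Lemma vring_subring : subring_closed vring_pred.
Proof.
split=> [|x y|x y]; rewrite !inE ?vfun1 // => x0 y0.
  apply: le_trans (vfunD v _ _); rewrite le_min x0 -mulN1r vfunM vfunN1.
  by rewrite add0r.
by rewrite vfunM vinf_addr_ge0.
Qed.

HB.instance Definition _ :=
  GRing.isSubringClosed.Build R vring_pred vring_subring.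

Record vring := VRing { vring_val : R; vring_valP : vring_val \in vring_pred }.

HB.instance Definition _ := [isSub for vring_val].
HB.instance Definition _ := [Choice of vring by <:].
HB.instance Definition _ := [SubChoice_isSubComNzRing of vring by <:].

Definition vmax : {pred vring} := [pred x | Fin 0 < v (val x)].

Lemma vmax_idealr : idealr_closed vmax.
Proof.
split=> [||a x y]; rewrite !inE ?rmorph0 ?rmorph1 ?vfun0 ?vfun1 ?ltxx //.
move=> x0 y0; rewrite rmorphD rmorphM.
apply: lt_le_trans (vfunD v _ _); rewrite lt_min y0 andbT vfunM.
have: Fin 0 <= v (val a) by apply: vring_valP a.
case: (v (val a)) (v (val x)) x0 => [g|] [h|] //= h0 g0.
have h0' : Fin 0 <= (Some h : vinf G) by apply: ltW.
rewrite lt_neqAle vinf_addr_ge0 // andbT.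
apply/eqP => -[] gh.
have : (h : G) <= 0.
  by rewrite [leRHS]gh -[leLHS]add0r addrC [leRHS]addrC; apply: oab_leD2l.
by move=> h_le0; move: h0; rewrite ltNge => /negP; apply.
Qed.

HB.instance Definition _ := isIdealr.Build vring vmax vmax_idealr.

Definition residue := {ideal_quot vmax}.

Definition value_group : set G := [set g | exists x, v x = Fin g].

End ValuationRing.

Section ValuationRingMap.
Variables (R S : comNzRingType) (G : orderedAbType).
Variables (f : {rmorphism R -> S}) (v : valuation S G).

Definition vring_map (x : vring (vcomp f v)) : vring v :=
  VRing (vring_valP x : f (val x) \in vring_pred v).

Lemma vring_map_zmod_morphism : zmod_morphism vring_map.
Proof. by move=> x y; apply: val_inj; rewrite /= !rmorphB. Qed.

Lemma vring_map_monoid_morphism : monoid_morphism vring_map.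
Proof.
by split=> [|x y]; apply: val_inj; rewrite /= ?rmorph1 // !rmorphM.
Qed.

HB.instance Definition _ := GRing.isZmodMorphism.Build
  (vring (vcomp f v)) (vring v) vring_map vring_map_zmod_morphism.
HB.instance Definition _ := GRing.isMonoidMorphism.Build
  (vring (vcomp f v)) (vring v) vring_map vring_map_monoid_morphism.

End ValuationRingMap.

(* The module of Kähler differentials of A over R along f : R -> A: the free
   A-module on the symbols da (a in A), modulo the submodule generated by
   d(a + b) - da - db, d(ab) - a db - b da and d(f r). *)
Section Kahler.
Variables (R A : comNzRingType) (f : {rmorphism R -> A}).

Local Notation Free := {freeg A / A}.
Local Notation "'<d' a >" := (<< a >> : Free) (at level 0, a at level 50).

Inductive kahler_rel : Free -> Prop :=
| Kahler_rel_add a b : kahler_rel (<d a + b> - <d a> - <d b>)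
| Kahler_rel_mul a b : kahler_rel (<d a * b> - a *: <d b> - b *: <d a>)
| Kahler_rel_cst r : kahler_rel <d f r>.

Inductive kahler_span : Free -> Prop :=
| Kahler_span0 : kahler_span 0
| Kahler_spanD a x y :
    kahler_rel x -> kahler_span y -> kahler_span (a *: x + y).

Definition kahler_sub : {pred Free} := [pred x | `[< kahler_span x >]].

Lemma kahler_spanDD x y : kahler_span x -> kahler_span y -> kahler_span (x + y).
Proof.
move=> + ys; elim=> [|a z w zr _ IH]; first by rewrite add0r.
by rewrite -addrA; apply: Kahler_spanD.
Qed.

Lemma kahler_spanZ a x : kahler_span x -> kahler_span (a *: x).
Proof.
elim=> [|b z w zr _ IH]; first by rewrite scaler0; apply: Kahler_span0.
by rewrite scalerDr scalerA; apply: Kahler_spanD.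
Qed.

Lemma kahler_sub_zmod : zmod_closed kahler_sub.
Proof.
split=> [|x y /asboolP xs /asboolP ys]; apply/asboolP.
  exact: Kahler_span0.
by rewrite -scaleN1r; apply: kahler_spanDD (kahler_spanZ _ _).
Qed.

HB.instance Definition _ :=
  GRing.isZmodClosed.Build Free kahler_sub kahler_sub_zmod.

Definition kahler := Quotient.quot kahler_sub.
HB.instance Definition _ := GRing.Zmodule.on kahler.

Local Notation pi := (\pi_(Quotient.quot kahler_sub)%qT).

Definition kahler_scale (a : A) (w : kahler) : kahler := pi (a *: repr w).

Lemma kahler_pi_eq (x y : Free) : kahler_span (x - y) -> pi x = pi y.
Proof. by move=> xy; apply/eqP; rewrite -Quotient.idealrBE; apply/asboolP. Qed.

Lemma kahler_scale_pi a x : kahler_scale a (pi x) = pi (a *: x).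
Proof.
apply: kahler_pi_eq; rewrite -scalerBr; apply: kahler_spanZ.
by apply/asboolP; rewrite -[`[< _ >]]/(_ \in kahler_sub) Quotient.idealrBE reprK.
Qed.

Lemma kahler_repr (w : kahler) : w = pi (repr w).
Proof. by rewrite reprK. Qed.

Lemma kahler_scaleA a b w :
  kahler_scale a (kahler_scale b w) = kahler_scale (a * b) w.
Proof. by rewrite (kahler_repr w) !kahler_scale_pi scalerA. Qed.

Lemma kahler_scale1 : left_id 1 kahler_scale.
Proof. by move=> w; rewrite (kahler_repr w) kahler_scale_pi scale1r. Qed.

Lemma kahler_scaleDr : right_distributive kahler_scale +%R.
Proof.
move=> a w z; rewrite (kahler_repr w) (kahler_repr z) -raddfD.
by rewrite !kahler_scale_pi scalerDr raddfD.
Qed.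

Lemma kahler_scaleDl w : {morph kahler_scale^~ w : a b / a + b}.
Proof.
move=> a b; rewrite (kahler_repr w) !kahler_scale_pi scalerDl.
by rewrite raddfD.
Qed.

HB.instance Definition _ := GRing.Zmodule_isLmodule.Build A kahler
  kahler_scaleA kahler_scale1 kahler_scaleDr kahler_scaleDl.

Definition kahler_d (a : A) : kahler := pi <d a>.

Lemma kahler_pi0 (x : Free) : kahler_rel x -> pi x = 0.
Proof.
move=> xr; rewrite -(raddf0 pi); apply: kahler_pi_eq.
by rewrite subr0 -[x]scale1r -[1 *: x]addr0; apply: Kahler_spanD Kahler_span0.
Qed.

Lemma kahler_dD a b : kahler_d (a + b) = kahler_d a + kahler_d b.
Proof.
apply/eqP; rewrite -subr_eq0 opprD addrA; apply/eqP.
by rewrite -!raddfB; apply: kahler_pi0; apply: Kahler_rel_add.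
Qed.

Lemma kahler_dM a b :
  kahler_d (a * b) = a *: kahler_d b + b *: kahler_d a.
Proof.
apply/eqP; rewrite -subr_eq0 opprD addrA; apply/eqP.
rewrite -![_ *: kahler_d _]/(kahler_scale _ _) !kahler_scale_pi.
by rewrite -!raddfB; apply: kahler_pi0; apply: Kahler_rel_mul.
Qed.

Lemma kahler_d_cst r : kahler_d (f r) = 0.
Proof. by apply: kahler_pi0; apply: Kahler_rel_cst. Qed.

Section Universal.
Variables (M : lmodType A) (D : A -> M).
Hypothesis DD : forall a b, D (a + b) = D a + D b.
Hypothesis DM : forall a b, D (a * b) = a *: D b + b *: D a.
Hypothesis Dcst : forall r, D (f r) = 0.

Let h : Free -> M := fglift D.

Let hB x y : h (x - y) = h x - h y.
Proof. exact: lift_is_additive. Qed.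

Let h0 : h 0 = 0.
Proof. by rewrite -(subrr 0) hB subrr. Qed.

Let hD x y : h (x + y) = h x + h y.
Proof.
have hN : h (- y) = - h y by rewrite -sub0r hB h0 sub0r.
by have := hB x (- y); rewrite hN !opprK.
Qed.

Let hZ a x : h (a *: x) = a *: h x.
Proof.
have hs (r : seq A) (E : A -> Free) :
  h (\sum_(i <- r) E i) = \sum_(i <- r) h (E i) := big_morph h hD h0 _ _ _.
have -> : h x = \sum_(z <- dom x) coeff z x *: D z.
  by rewrite -{1}(freeg_sumE x) hs; apply: eq_bigr => z _; rewrite /h liftU.
rewrite -[a *: x]/(fgscale a x) /fgscale hs scaler_sumr.
by apply: eq_bigr => z _; rewrite /h liftU scalerA.
Qed.

Let h_span x : kahler_span x -> h x = 0.
Proof.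
elim=> [|a y z + _ IH]; first exact: h0.
rewrite hD hZ IH addr0 => yr; rewrite [h y](_ : _ = 0) ?scaler0 //.
have hd b : h <d b> = D b by rewrite /h liftU scale1r.
case: yr => [b c|b c|r]; rewrite ?hd //.
  by rewrite !hB !hd DD addrAC addrK subrr.
by rewrite !hB !hZ !hd DM addrAC addrK subrr.
Qed.

Definition kahler_lift (w : kahler) : M := h (repr w).

Lemma kahler_lift_pi x : kahler_lift (pi x) = h x.
Proof.
apply/eqP; rewrite -subr_eq0 -hB; apply/eqP/h_span/asboolP.
by rewrite -[`[< _ >]]/(_ \in kahler_sub) Quotient.idealrBE reprK.
Qed.

Lemma kahler_lift_linear : linear kahler_lift.
Proof.
move=> a w z.
have -> : a *: w + z = pi (a *: repr w + repr z).
  by rewrite raddfD /= -kahler_scale_pi !reprK.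
by rewrite kahler_lift_pi hD hZ.
Qed.

Lemma kahler_liftE a : kahler_lift (kahler_d a) = D a.
Proof. by rewrite kahler_lift_pi /h liftU scale1r. Qed.

End Universal.

End Kahler.

Section Extension.
Variables (K : fieldType) (L : fieldExtType K) (G : orderedAbType).
Variables (v : valuation L G) (eta : L).

Definition vbase : valuation K G := vcomp (in_alg L) v.

(* The second conjunct says that the natural map from the residue ring of
   vbase to that of v is onto. *)
Definition immediate :=
  value_group vbase = value_group v /\
  (forall z : residue v,
     exists a : vring vbase, z = \pi_(residue v)%qT (vring_map a)).

Definition pure_immediate :=
  [/\ <<1; eta>>%VS = fullv, immediate
    & forall f : {poly K}, (size f <= \dim {:L})%N ->
      exists c : K, forall b : K,
        v (eta - c%:A) <= v (eta - b%:A) -> vbase f.[b] = vbase f.[c]].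

(* Two valuations are identified when they have the same valuation ring. *)
Definition unibranched :=
  forall (G' : orderedAbType) (w : valuation L G'),
    (forall a : K, (a%:A \in vring_pred w) = (a \in vring_pred vbase)) ->
    vring_pred w =i vring_pred v.

Definition pure_defect := pure_immediate /\ unibranched.
Definition branched_pure := pure_immediate /\ ~ unibranched.

Definition nu : valuation {poly K} G := vcomp (horner_alg eta) v.

Definition Omega : lmodType (vring v) := kahler (@vring_map _ _ _ (in_alg L) v).

End Extension.

Section KeyPolynomials.
Variables (K : fieldType) (Kbar : closedFieldType).
Variables (iota : {rmorphism K -> Kbar}).
Variables (G : orderedAbType) (mu : valuation {poly Kbar} G).
Implicit Types f g q F P Q R : {poly K}.

Definition roots_bar f : seq Kbar :=
  sval (closed_field_poly_normal (map_poly iota f)).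

(* Meaningful for nonconstant f, whose list of roots is nonempty. *)
Definition delta f : vinf G :=
  let s := [seq mu ('X - a%:P) | a <- roots_bar f] in
  \big[Order.max/head Infty s]_(d <- s) d.

Lemma roots_barP f a :
  (1 < size f)%N -> (a \in roots_bar f) = root (map_poly iota f) a.
Proof.
move=> sf; rewrite /roots_bar; case: closed_field_poly_normal => r /= ->.
rewrite rootZ ?root_prod_XsubC // lead_coef_map fmorph_eq0 lead_coef_eq0.
by rewrite -size_poly_gt0; apply: ltn_trans sf.
Qed.

Lemma deltaP f : (1 < size f)%N ->
  (exists2 a, root (map_poly iota f) a & delta f = mu ('X - a%:P)) /\
  (forall a, root (map_poly iota f) a -> mu ('X - a%:P) <= delta f).
Proof.
move=> sf; split; last first.
  move=> a; rewrite -roots_barP // => ar; rewrite /delta.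
  set s := [seq _ | _ <- _].
  apply: (@le_bigmax_seq _ _ _ s _ _ predT id) => //.
  exact: (map_f (fun a => mu ('X - a%:P)) ar).
have [a0 a0f] : exists a, a \in roots_bar f.
  have /closed_rootP[a] : size (map_poly iota f) != 1%N.
    by rewrite size_map_poly; case: (size f) sf => [|[]].
  by rewrite -roots_barP //; exists a.
suff /mapP[a ar ->] : delta f \in [seq mu ('X - a%:P) | a <- roots_bar f].
  by exists a => //; rewrite -roots_barP.
rewrite /delta; case: (roots_bar f) a0f => // b r _; set s := map _ _.
have s0 : head Infty s \in s by rewrite mem_head.
rewrite big_seq; elim/big_ind: _ => // x y xs ys.
by rewrite maxEle; case: ifP.
Qed.

Definition key_polynomial Q :=
  [/\ Q \is monic, (1 < size Q)%N
    & forall f, (1 < size f)%N -> delta Q <= delta f ->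
        (size Q <= size f)%N].

Definition Psi (m : nat) : set {poly K} :=
  [set Q | key_polynomial Q /\ size Q = m.+1].

Definition key_polynomial_for (m : nat) F :=
  [/\ key_polynomial F, (m.+1 < size F)%N
    & forall Q, key_polynomial Q -> (m.+1 < size Q)%N ->
        (size F <= size Q)%N].

(* F_{l,q}, the coefficient of q ^+ l in the q-expansion of F. *)
Definition expansion_coef F q (l : nat) : {poly K} := (F %/ q ^+ l) %% q.

Lemma expansionE F q n : (size F <= n)%N -> (1 < size q)%N ->
  F = \sum_(l < n) expansion_coef F q l * q ^+ l.
Proof.
move=> + sq; have q0 : q != 0 by rewrite -size_poly_gt0 (ltn_trans _ sq).
elim: n F => [|n IH] F sF.
  by rewrite big_ord0; apply/eqP; rewrite -size_poly_leq0.
rewrite big_ord_recl /expansion_coef expr0 divp1 mulr1 {1}(divp_eq F q) addrC.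
congr (_ + _); rewrite {1}(IH (F %/ q)) ?mulr_suml; last first.
  rewrite size_divp // leq_subLR (leq_trans sF) //.
  by case: (size q) sq => [|[|k]] //= _; rewrite addSn ltnS leq_addl.
apply: eq_bigr => i _; rewrite lift0 -mulrA -exprSr.
by rewrite /expansion_coef divp_divl -exprS.
Qed.

(* For l >= size F the coefficients of the expansion vanish when q is
   nonconstant, so that the sum ranges over all positive l in B. *)
Definition expansion_restr F q (B : set nat) : {poly K} :=
  expansion_coef F q 0 +
  \sum_(1 <= l < size F | l \in B) expansion_coef F q l * q ^+ l.

Lemma expansion_coef_small F q l : (1 < size q)%N -> (size F <= l)%N ->
  expansion_coef F q l = 0.
Proof.
move=> sq Fl; rewrite /expansion_coef divp_small ?mod0p //.
have q0 : q != 0 by rewrite -size_poly_gt0 (ltn_trans _ sq).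
have ql0 : q ^+ l != 0 by rewrite expf_neq0.
rewrite -(prednK (_ : 0 < size (q ^+ l))%N) ?size_poly_gt0 // size_exp ltnS.
rewrite (leq_trans Fl) //.
by case: (size q) sq => [|[|k]] //= _; rewrite mulSn leq_addr.
Qed.

Variable nuK : valuation {poly K} G.

Definition cofinal (A B : set {poly K}) :=
  A `<=` B /\ forall P, B P -> exists2 R, A R & nuK P <= nuK R.

Definition well_ordered (A : set {poly K}) :=
  (forall P Q, A P -> A Q -> nuK P = nuK Q -> P = Q) /\
  (forall C, C `<=` A -> C !=set0 ->
     exists2 P, C P & forall Q, C Q -> nuK P <= nuK Q).

Definition exponents_of_minimal (Q1 : set {poly K}) F (B : set nat) :=
  [/\ key_polynomial_for 1 F,
      B `<=` [set l | (0 < l)%N]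
    & exists2 Q, Q1 Q &
      (forall R, Q1 R -> nuK Q <= nuK R ->
         key_polynomial_for 1 (expansion_restr F R B)) /\
      (forall s, B s -> exists2 C, cofinal C Q1 &
         forall R, C R ->
           ~ key_polynomial_for 1 (expansion_restr F R (B `\ s)))].

End KeyPolynomials.

(* Main.v *)
Require Import Defs.
From HB Require Import structures.
From mathcomp Require Import all_boot all_order all_algebra all_field.
From mathcomp Require Import generic_quotient ring_quotient.
From mathcomp Require Import boolp classical_sets.
From mathcomp.multinomials Require Import freeg.

Set Implicit Arguments.
Unset Strict Implicit.
Unset Printing Implicit Defensive.

Import Order.TTheory GRing.Theory.

Local Open Scope classical_set_scope.
Local Open Scope ring_scope.

(** Put n = [L : K], let g be the minimal polynomial of eta over K, and let b
    run through the elements of K that approach eta. Since L is immediate over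
    K, the values v (eta - b) have no maximum; a property of b is said to hold
    eventually when it holds as soon as v (eta - b) is large enough.

    Call an element a of the algebraic closure unbounded when X - a has at
    least the value v (eta - b) for every b in K. If f has an unbounded root,
    then v (f b) is eventually strictly increasing; otherwise v (f b)
    eventually equals v (f eta). Purity forces the second case in degree less
    than n, so that the key polynomials for Psi_1 are exactly the monic
    polynomials of degree n with an unbounded root
    ([key_polynomial_for1P]); g is one of them, its value being infinite. As a
    consequence, if F is such a key polynomial and h has degree less than n,
    then F + h is again one iff v (h eta) exceeds v (F d) for d close to eta
    ([approx_keyD]).

    The expansion of F in powers of X - b is its Taylor expansion at b. Call
    the derivative of F negligible if, for some b, the value of
    F' (eta) (eta - b), which is eventually that of the linear Taylor term,
    exceeds all the values v (F d). By the perturbation criterion,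
    this does not depend on the key polynomial F, and 1 belongs to B iff the
    derivative of F is not negligible. One direction removes the linear term
    from a truncation; the other uses that the values of the Taylor terms are
    eventually distinct, so that a sum of such terms has at most the value of
    each of them.

    It remains to compare with Omega for F = g. Choose c in K with
    v c = v (eta - b), and set eta_b = (eta - b) / c. Every element of the
    valuation ring is an integral polynomial in eta_b for b close to eta, so
    that Omega is generated by the differentials d eta_b. If the derivative of
    g is not negligible, then the equation of eta_d, for d close to eta, kills
    d eta_b, and Omega = 0 ([Omega_eq0]). If it is negligible, f (eta) |->
    f' (eta), for f of degree less than n, is a derivation modulo the
    submodule of the x with v x > - v (eta - b) for a suitable b, and it does
    not vanish on eta_b; hence Omega is not zero ([Omega_neq0]). *)

(** * Values in an ordered group with infinity *)

Section ExtendedValueGroup.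
Variable G : orderedAbType.
Implicit Types (g h : G) (x y z t : vinf G).

Lemma vinf_leInfty x : x <= Infty. Proof. by case: x. Qed.

Lemma vinf_ltInfty x : (x < Infty) = (x != Infty).
Proof. by rewrite lt_neqAle vinf_leInfty andbT. Qed.

Lemma vinf_lt_neqInfty x y : x < y -> x != Infty.
Proof. by move=> xy; rewrite -vinf_ltInfty (lt_le_trans xy) ?vinf_leInfty. Qed.

Lemma vinf_FinP x : x != Infty -> exists g, x = Fin g.
Proof. by case: x => [g|] // _; exists g. Qed.

Lemma vinf_addInfty x : x + Infty = Infty.
Proof. by case: x. Qed.

Lemma vinf_add_neqInfty x y : (x + y != Infty) = (x != Infty) && (y != Infty).
Proof. by case: x y => [a|] [b|]. Qed.

Lemma vinf_leD2l z x y : x <= y -> z + x <= z + y.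
Proof. by case: z x y => [c|] [a|] [b|] //= ab; apply: oab_leD2l. Qed.

Lemma vinf_leD x y z t : x <= y -> z <= t -> x + z <= y + t.
Proof.
move=> xy zt; apply: le_trans (vinf_leD2l _ zt) _.
by rewrite addrC [leRHS]addrC vinf_leD2l.
Qed.

Lemma vinf_FinNK g x : Fin (- g) + (Fin g + x) = x.
Proof. by case: x => [a|] //=; congr Some; rewrite addrA addNr add0r. Qed.

Lemma vinf_leD2lE z x y : z != Infty -> (z + x <= z + y) = (x <= y).
Proof.
move=> /vinf_FinP[g ->]; apply/idP/idP => [|/vinf_leD2l//].
by move=> /(vinf_leD2l (Fin (- g))); rewrite !vinf_FinNK.
Qed.

Lemma vinf_ltD2l z x y : z != Infty -> (z + x < z + y) = (x < y).
Proof. by move=> zf; rewrite !ltNge vinf_leD2lE. Qed.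

Lemma vinf_lt_leD x y z t : x < y -> z <= t -> z != Infty -> x + z < y + t.
Proof.
move=> xy zt zf; apply: (@lt_le_trans _ _ (y + z)); last exact: vinf_leD2l.
by rewrite addrC [ltRHS]addrC vinf_ltD2l.
Qed.

Lemma vinf_sum_neqInfty (I : eqType) (s : seq I) (x : I -> vinf G) :
  (forall i, i \in s -> x i != Infty) -> \sum_(i <- s) x i != Infty.
Proof.
move=> xf; rewrite big_seq; elim/big_ind: _ => // u w uf wf.
by rewrite vinf_add_neqInfty uf.
Qed.

Lemma vinf_le_sum (I : eqType) (s : seq I) (x y : I -> vinf G) :
  (forall i, i \in s -> x i <= y i) -> \sum_(i <- s) x i <= \sum_(i <- s) y i.
Proof.
move=> xy; rewrite big_seq [leRHS]big_seq; elim/big_ind2: _ => //.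
by move=> *; apply: vinf_leD.
Qed.

Lemma vinf_lt_sum (I : eqType) (s : seq I) (x y : I -> vinf G) j :
    (forall i, i \in s -> x i <= y i) -> (forall i, i \in s -> x i != Infty) ->
    j \in s -> x j < y j ->
  \sum_(i <- s) x i < \sum_(i <- s) y i.
Proof.
move=> xy xf js xyj; rewrite !(big_rem j js) /=.
have rs i : i \in rem j s -> i \in s by apply: mem_rem.
apply: vinf_lt_leD => //; first by apply: vinf_le_sum => i /rs /xy.
by apply: vinf_sum_neqInfty => i /rs /xf.
Qed.

Lemma vinf_mulrn_neqInfty x k : x != Infty -> x *+ k != Infty.
Proof.
by move=> xf; elim: k => [|k IH]; rewrite ?mulr0n ?mulrS ?vinf_add_neqInfty ?xf.
Qed.

Lemma vinf_ltMn x y k : x < y -> x *+ k.+1 < y *+ k.+1.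
Proof.
move=> xy; elim: k => [|k IH]; first by rewrite !mulr1n.
rewrite mulrS [ltRHS]mulrS; apply: vinf_lt_leD (ltW IH) _ => //.
exact/vinf_mulrn_neqInfty/(vinf_lt_neqInfty xy).
Qed.

Lemma vinf_addI z x y : z != Infty -> z + x = z + y -> x = y.
Proof.
move=> zf e; apply/le_anti.
by rewrite -(vinf_leD2lE _ _ zf) -(vinf_leD2lE y x zf) e lexx.
Qed.

(** Multiplication by a positive integer is strictly increasing, so that two
    affine functions of distinct slopes agree in at most one point. *)
Lemma vinf_affine_neq x y z t (k l : nat) :
    x != Infty -> z < t -> t != Infty -> k != l ->
    x + z *+ k = y + z *+ l ->
  x + t *+ k != y + t *+ l.
Proof.
move=> xf zt tf kl ez; apply/eqP => et.
have zf := vinf_lt_neqInfty zt.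
have nf u (m : nat) : u != Infty -> u *+ m != Infty := @vinf_mulrn_neqInfty u m.
have yf : y != Infty.
  have : x + z *+ k != Infty by rewrite vinf_add_neqInfty xf nf.
  by rewrite ez vinf_add_neqInfty => /andP[].
have wlog_lt x' y' (k' l' : nat) : y' != Infty -> (k' < l')%N ->
    x' + z *+ k' = y' + z *+ l' -> x' + t *+ k' = y' + t *+ l' -> False.
  move=> yf' /subnKC <-; set m := (l' - k'.+1)%N.
  have split_ u : u != Infty ->
      x' + u *+ k' = y' + u *+ (k'.+1 + m) -> x' = y' + u *+ m.+1.
    move=> uf e; apply: (vinf_addI (nf u k' uf)).
    by rewrite addrC e addrCA -mulrnDr addnS.
  move=> /(split_ _ zf) e1 /(split_ _ tf) e2.
  have e := vinf_addI yf' (etrans (esym e1) e2).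
  by have := vinf_ltMn m zt; rewrite e ltxx.
move: kl; rewrite neq_ltn => /orP[/wlog_lt|/wlog_lt].
  by move/(_ _ _ yf ez et).
by move/(_ _ _ xf (esym ez) (esym et)).
Qed.
End ExtendedValueGroup.

(** * Valuations of sums and products *)

Section Valuations.
Variables (R : comNzRingType) (G : orderedAbType) (v : valuation R G).
Implicit Types x y : R.

Lemma vfunN x : v (- x) = v x.
Proof. by rewrite -mulN1r vfunM vfunN1 add0r. Qed.

Lemma vfunBC x y : v (x - y) = v (y - x).
Proof. by rewrite -vfunN opprB. Qed.

Lemma vfunB_ge x y : Order.min (v x) (v y) <= v (x - y).
Proof. by rewrite -(vfunN y) vfunD. Qed.

Lemma vfunD_leD z c x y :
  z <= v x + c -> z <= v y + c -> z <= v (x + y) + c.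
Proof.
wlog xy : x y / v x <= v y => [IH|] zx zy.
  by have [/IH|/ltW/IH] := leP (v x) (v y); rewrite 1?[y + x]addrC; apply.
apply: le_trans zx _; rewrite vinf_leD //.
by apply: le_trans (vfunD v _ _); rewrite le_min lexx.
Qed.

Lemma vfunD_ltD z c x y :
  z < v x + c -> z < v y + c -> z < v (x + y) + c.
Proof.
wlog xy : x y / v x <= v y => [IH|] zx zy.
  by have [/IH|/ltW/IH] := leP (v x) (v y); rewrite 1?[y + x]addrC; apply.
apply: lt_le_trans zx _; rewrite vinf_leD //.
by apply: le_trans (vfunD v _ _); rewrite le_min lexx.
Qed.

Lemma vfunD_lt x y : v x < v y -> v (x + y) = v x.
Proof.
move=> xy; apply/le_anti/andP; split; last first.
  by apply: le_trans (vfunD v _ _); rewrite le_min lexx ltW.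
rewrite leNgt; apply/negP => h.
have := vfunB_ge (x + y) y; rewrite addrK leNgt lt_min h xy //.
Qed.

Lemma vfunB_neq x y : v x != v y -> v (x - y) = Order.min (v x) (v y).
Proof.
rewrite neq_lt => /orP[xy|yx].
  by rewrite vfunD_lt ?vfunN // min_l // ltW.
by rewrite vfunBC vfunD_lt ?vfunN // min_r // ltW.
Qed.

Lemma vfunX x k : v (x ^+ k) = v x *+ k.
Proof.
by elim: k => [|k IH]; rewrite ?expr0 ?vfun1 // exprS vfunM IH mulrS.
Qed.

Lemma vfun_prod (I : Type) (s : seq I) (E : I -> R) :
  v (\prod_(i <- s) E i) = \sum_(i <- s) v (E i).
Proof. exact: (big_morph v (vfunM v) (vfun1 v)). Qed.

(** The coefficient of degree l is a sum of products of all but l of the t,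
    and each of the t that are left out has value at most c. *)
Lemma coef_prod_XD_le (s : seq R) (c : vinf G) l :
    (forall t, t \in s -> v t <= c) ->
  \sum_(t <- s) v t <= v ((\prod_(t <- s) ('X + t%:P))`_l) + c *+ l.
Proof.
elim: s l => [|t s IH] l sc.
  rewrite !big_nil coef1; case: l => [|l] /=; last first.
    by rewrite vfun0 addrC vinf_addInfty vinf_leInfty.
  by rewrite vfun1 mulr0n addr0.
rewrite !big_cons mulrDl coefD coefXM coefCM.
have {}IH k : \sum_(j <- s) v j <= v (\prod_(j <- s) ('X + j%:P))`_k + c *+ k.
  by apply: IH => j js; apply: sc; rewrite inE js orbT.
set p := \prod_(_ <- _) _ in IH *.
have h : v t + \sum_(j <- s) v j <= v (t * p`_l) + c *+ l.
  by rewrite vfunM -addrA vinf_leD2l.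
case: l h => [|l] h /=; first by rewrite add0r.
have h' : v t + \sum_(j <- s) v j <= v p`_l + c *+ l.+1.
  by rewrite mulrS addrCA vinf_leD ?sc ?mem_head.
exact: vfunD_leD h' h.
Qed.

(** Without cancellation between the finite values of the terms, a sum has
    the least of these values. *)
Lemma vfun_sum_le (I : eqType) (s : seq I) (E : I -> R) :
    uniq s ->
    {in s &, forall i j, i != j -> v (E i) != Infty -> v (E i) != v (E j)} ->
  forall i, i \in s -> v (\sum_(j <- s) E j) <= v (E i).
Proof.
move=> us dis.
suff [] : (forall i, i \in s -> v (\sum_(j <- s) E j) <= v (E i)) /\
  (v (\sum_(j <- s) E j) = Infty \/
   exists2 i, i \in s & v (\sum_(j <- s) E j) = v (E i)) by [].
elim: s us dis => [|k s IH] /=; first by rewrite big_nil vfun0; split; auto.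
move=> /andP[ks us] dis.
have {IH}[] := IH us.
  by move=> i j si sj; apply: dis; rewrite inE (si, sj) orbT.
rewrite big_cons; set S := \sum_(j <- s) _ => Sle Sval.
have Ek : v (E k) != Infty -> v (E k) != v S.
  move=> kf; case: Sval => [->//|[i si ->]].
  apply: dis => //; rewrite ?inE ?eqxx ?si ?orbT //.
  by apply: contraNneq ks => ->.
have [e|e] := eqVneq (v (E k)) (v S).
  have kI : v (E k) = Infty.
    by apply/eqP; apply/negPn/negP => /Ek; rewrite e eqxx.
  have SI : v S = Infty by rewrite -e.
  have -> : v (E k + S) = Infty.
    apply/eqP; rewrite -[_ == _]negbK -vinf_ltInfty -leNgt.
    by apply: le_trans (vfunD v _ _); rewrite le_min kI SI lexx.
  split; last by left.
  move=> i; rewrite inE => /predU1P[->|si]; first by rewrite kI.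
  by rewrite -SI Sle.
move: e; rewrite neq_lt => /orP[lt|lt].
  rewrite vfunD_lt //; split; last by right; exists k; rewrite ?mem_head.
  move=> i; rewrite inE => /predU1P[->//|/Sle]; exact: le_trans (ltW lt).
rewrite addrC vfunD_lt //; split.
  by move=> i; rewrite inE => /predU1P[->|/Sle//]; apply: ltW.
case: Sval => [->|[i si ->]]; first by left.
by right; exists i; rewrite ?inE ?si ?orbT.
Qed.

End Valuations.

Section FieldValuations.
Variables (F : fieldType) (G : orderedAbType) (v : valuation F G).

Lemma vfun_eqInfty x : (v x == Infty) = (x == 0).
Proof.
apply/eqP/eqP => [xI|->]; last exact: vfun0.
apply/eqP/negPn/negP => x0.
by have := vfun1 v; rewrite -(mulfV x0) vfunM xI.
Qed.

Lemma vfun_div_ge0 x y : y != 0 -> (Fin 0 <= v (x / y)) = (v y <= v x).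
Proof.
move=> y0; rewrite -(vinf_leD2lE _ _ (_ : v y != Infty)) ?vfun_eqInfty //.
by rewrite -vfunM mulrC divfK // addr0.
Qed.
End FieldValuations.

(** * Taylor expansions and truncations *)

Section TaylorCoefficients.
Variable R : comNzRingType.
Implicit Types p : {poly R}.

(** The divided derivatives are the Taylor coefficients, also in positive
    characteristic. *)
Lemma coef_comp_polyXD p (b : R) l : (p \Po ('X + b%:P))`_l = p^`N(l).[b].
Proof.
rewrite /comp_poly addrC nderiv_taylor; last exact: commr_polyX.
under eq_bigr => i _ do rewrite nderivn_map horner_map /= mul_polyC.
rewrite -(poly_def _ (fun i => p^`N(i).[b])) coef_poly size_map_polyC.
by case: ltnP => // lp; rewrite nderivn_poly0 // horner0.
Qed.
End TaylorCoefficients.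

Section Expansions.
Variable K : fieldType.
Implicit Types (F : {poly K}) (b : K) (B : set nat).

Lemma taylor_XsubC F b N : (size F <= N)%N ->
  F = \sum_(i < N) (F^`N(i).[b])%:P * ('X - b%:P) ^+ i.
Proof.
move=> sF; have {1}-> : F = (F \Po ('X + b%:P)) \Po ('X - b%:P).
  by rewrite -comp_polyA comp_polyD comp_polyX comp_polyC subrK comp_polyXr.
rewrite {1}/comp_poly (@horner_coef_wide _ N).
  apply: eq_bigr => i _; rewrite coef_map /=; congr (_%:P * _).
  exact: coef_comp_polyXD.
rewrite size_map_polyC size_comp_poly2 // size_XaddC //.
Qed.

(** Dividing the Taylor expansion by the power of degree l leaves the terms
    from l on, and the remainder modulo X - b is the first of these. *)
Lemma expansion_coef_XsubC F b l :
  expansion_coef F ('X - b%:P) l = (F^`N(l).[b])%:P.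
Proof.
have := @taylor_XsubC F b (l + (size F).+1) _.
rewrite addnS leqW ?leq_addl // => /(_ isT).
rewrite -addnS big_split_ord /= addrC.
set A := \sum_(i < l) _; set T := \sum_(i < _) _ => FE.
pose C := \sum_(i < (size F).+1) (F^`N(l + i).[b])%:P * ('X - b%:P) ^+ i.
have TE : T = C * ('X - b%:P) ^+ l.
  rewrite mulr_suml; apply: eq_bigr => i _.
  by rewrite -mulrA -exprD addnC.
have sA : (size A < size (('X - b%:P) ^+ l))%N.
  rewrite size_exp_XsubC ltnS (leq_trans (size_sum _ _ _)) //.
  apply/bigmax_leqP => i _; rewrite mul_polyC.
  rewrite (leq_trans (size_scale_leq _ _)) //.
  by rewrite size_exp_XsubC.
rewrite /expansion_coef {1}FE TE divp_addl_mul_small //.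
rewrite /C big_ord_recl expr0 mulr1 addn0.
under eq_bigr => i _ do rewrite lift0 exprSr mulrA.
rewrite -mulr_suml addrC modp_addl_mul_small //.
by rewrite size_XsubC ltnS size_polyC leq_b1.
Qed.

Lemma expansion_restrE F b B : expansion_restr F ('X - b%:P) B =
  F.[b]%:P +
  \sum_(1 <= l < size F | l \in B) (F^`N(l).[b])%:P * ('X - b%:P) ^+ l.
Proof.
rewrite /expansion_restr expansion_coef_XsubC nderivn0; congr (_ + _).
by apply: eq_bigr => l _; rewrite expansion_coef_XsubC.
Qed.

Lemma expansion_restr_compl F b B : (0 < size F)%N ->
  F = expansion_restr F ('X - b%:P) B +
  \sum_(1 <= l < size F | l \notin B) (F^`N(l).[b])%:P * ('X - b%:P) ^+ l.
Proof.
move=> sF; rewrite {1}(taylor_XsubC b (leqnn (size F))) expansion_restrE -addrA.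
rewrite -(big_mkord xpredT (fun i => (F^`N(i).[b])%:P * ('X - b%:P) ^+ i)).
by rewrite big_ltn // expr0 mulr1 nderivn0 (bigID (fun l => l \in B)).
Qed.

Lemma expansion_restr_remove F b B s : B s -> (0 < s < size F)%N ->
  expansion_restr F ('X - b%:P) (B `\ s) =
  expansion_restr F ('X - b%:P) B - (F^`N(s).[b])%:P * ('X - b%:P) ^+ s.
Proof.
move=> Bs sF; rewrite !expansion_restrE -addrA; congr (_ + _).
rewrite -[in RHS]big_filter (bigD1_seq s) ?filter_uniq ?iota_uniq //=;
  last first.
  by rewrite mem_filter mem_index_iota sF andbT; apply/asboolP.
rewrite [RHS]addrC addKr big_filter_cond; apply: eq_bigl => l.
by rewrite in_setD in_set1.
Qed.

End Expansions.

(** * Approximation of the generator *)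

Section Approximation.
Variables (K : fieldType) (L : fieldExtType K) (G : orderedAbType).
Variables (v : valuation L G) (eta : L).
Implicit Types (b c d : K) (P Q : K -> Prop).

(** How well b approximates eta: the value of X - b under [nu]. *)
Definition approx_val b := v (eta - b%:A).

Definition eventually P :=
  exists b0, forall b, approx_val b0 <= approx_val b -> P b.

Lemma eventually_mono P Q : (forall b, P b -> Q b) ->
  eventually P -> eventually Q.
Proof. by move=> PQ [b0 h]; exists b0 => b /h /PQ. Qed.

Lemma eventually_and P Q :
  eventually P -> eventually Q -> eventually (fun b => P b /\ Q b).
Proof.
move=> [b hb] [c hc]; have [bc|/ltW cb] := leP (approx_val b) (approx_val c).
  by exists c => d cd; split; [apply/hb/(le_trans bc) | apply: hc].
by exists b => d bd; split; [apply: hb | apply/hc/(le_trans cb)].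
Qed.

Lemma eventually_all (I : eqType) (s : seq I) (R : I -> K -> Prop) :
    (forall i, i \in s -> eventually (R i)) ->
  eventually (fun b => forall i, i \in s -> R i b).
Proof.
elim: s => [|i s IH] h; first by exists 0.
have hi := h i (mem_head _ _).
have hs : eventually (fun b => forall i, i \in s -> R i b).
  by apply: IH => j js; apply: h; rewrite inE js orbT.
apply: eventually_mono (eventually_and hi hs) => b [Rb Rs] j.
by rewrite inE => /predU1P[->|/Rs].
Qed.

Lemma eventually_ge b0 : eventually (fun b => approx_val b0 <= approx_val b).
Proof. by exists b0. Qed.

Lemma eventually_ex P : eventually P -> exists b, P b.
Proof. by move=> [b0 h]; exists b0; apply: h. Qed.

Lemma eventually_shift P : eventually P ->
  eventually (fun b => forall b', approx_val b <= approx_val b' -> P b').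
Proof. by move=> [b0 h]; exists b0 => b b0b b' bb'; apply/h/(le_trans b0b). Qed.

Hypothesis eta_notin : forall b, eta != b%:A.

Lemma approx_val_fin b : approx_val b != Infty.
Proof. by rewrite vfun_eqInfty subr_eq0. Qed.

Lemma immediate_dilation b : immediate v ->
  exists2 c, c != 0 & vbase v c = approx_val b.
Proof.
move=> [vgE _]; have /vinf_FinP[s bs] := approx_val_fin b.
have : value_group v s by exists (eta - b%:A).
rewrite -vgE => -[c cs]; exists c; last by rewrite cs bs.
by rewrite -(vfun_eqInfty (vbase v)) cs.
Qed.

(** The residue of (eta - b) / c, where v c = v (eta - b), lifts to some a in
    the base field, and b + c a is then strictly closer to eta than b. *)
Lemma immediate_approx_val_lt b :
  immediate v -> exists b', approx_val b < approx_val b'.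
Proof.
move=> im; have [c c0 cb] := immediate_dilation b im; have [_ resE] := im.
have cA : v c%:A = approx_val b by rewrite -cb.
have cA0 : c%:A != 0 :> L by rewrite scaler_eq0 oner_eq0 orbF.
have zP : (eta - b%:A) / c%:A \in vring_pred v.
  by rewrite inE vfun_div_ge0 // cA.
have [a /eqP] := resE (\pi_(residue v)%qT (VRing zP)).
rewrite -Quotient.idealrBE inE /= => za.
exists (b + c * val a).
have -> : approx_val (b + c * val a) =
    v (c%:A * ((eta - b%:A) / c%:A - (val a)%:A)).
  congr (v _); rewrite mulrBr mulrCA mulfV // mulr1 -addrA -opprD.
  by congr (_ - _); rewrite -![_%:A]/(in_alg L _) rmorphD rmorphM.
by rewrite vfunM cA -{1}[approx_val b]addr0 vinf_ltD2l ?approx_val_fin.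
Qed.

End Approximation.

(** * Values of a polynomial near the generator *)

Section Roots.
Variables (K : fieldType) (L : fieldExtType K) (G : orderedAbType).
Variables (v : valuation L G) (eta : L).
Variables (Kbar : closedFieldType) (iota : {rmorphism K -> Kbar}).
Variable mu : valuation {poly Kbar} G.
Hypothesis hmu : forall f : {poly K}, mu (map_poly iota f) = nu v eta f.
Hypothesis eta_notin : forall b : K, eta != b%:A.
Hypothesis gam_lt :
  forall b, exists b', approx_val v eta b < approx_val v eta b'.

Local Notation gam := (approx_val v eta).
Local Notation ev := (eventually v eta).
Local Notation nu := (nu v eta).
Local Notation val := (vbase v).
Implicit Types (b c d : K) (f h F : {poly K}) (a : Kbar).

Lemma nuC c : nu c%:P = val c.
Proof. by rewrite /Defs.nu /= horner_algC. Qed.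

Lemma nu_XsubC b : nu ('X - b%:P) = gam b.
Proof. by rewrite /Defs.nu /= rmorphB /= horner_algX horner_algC. Qed.

Lemma mu_iota c : mu (iota c)%:P = val c.
Proof. by rewrite -map_polyC hmu nuC. Qed.

Lemma mu_XsubC b : mu ('X - (iota b)%:P) = gam b.
Proof. by rewrite -map_polyXsubC hmu nu_XsubC. Qed.

Lemma val_eqInfty c : (val c == Infty) = (c == 0).
Proof. by rewrite vfun_eqInfty. Qed.

(** X - a measures the distance from a to eta, so the unbounded a are those that
    no element of K approximates eta better than. *)
Definition unbounded a := forall b, gam b <= mu ('X - a%:P).

Lemma bounded_ev a : ~ unbounded a -> ev (fun b => mu ('X - a%:P) < gam b).
Proof.
move=> /existsNP[b /negP]; rewrite -ltNge => ab.
by exists b => b'; apply: lt_le_trans.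
Qed.

Lemma unbounded_lt a b : unbounded a -> gam b < mu ('X - a%:P).
Proof. by move=> ua; have [b' bb'] := gam_lt b; apply: lt_le_trans (ua b'). Qed.

(** The ultrametric inequality for iota b - a = (X - a) - (X - iota b) is an
    equality unless both terms have the same value, and this can happen only
    for b of one particular value, which is eventually passed. *)
Lemma ev_dist a :
  ev (fun b => mu (iota b - a)%:P = Order.min (gam b) (mu ('X - a%:P))).
Proof.
have dist b : mu ('X - a%:P) != gam b ->
    mu (iota b - a)%:P = Order.min (gam b) (mu ('X - a%:P)).
  rewrite eq_sym -{1}mu_XsubC => ab.
  have -> : (iota b - a)%:P = ('X - a%:P) - ('X - (iota b)%:P).
    by rewrite polyCB opprB [RHS]addrC subrKA.
  by rewrite vfunBC vfunB_neq // mu_XsubC.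
have [ua|/bounded_ev] := pselect (unbounded a).
  by exists 0 => b _; apply: dist; rewrite gt_eqF ?unbounded_lt.
by apply: eventually_mono => b /lt_eqF /negbT; apply: dist.
Qed.

(** An eventual property of b, under which the values of f in b and of its
    Taylor coefficients at b can be read off the roots. *)
Definition separated f b := forall a, a \in roots_bar iota f ->
  mu (iota b - a)%:P = Order.min (gam b) (mu ('X - a%:P)).

Lemma ev_separated f : ev (separated f).
Proof. by apply: eventually_all => a _; apply: ev_dist. Qed.

Lemma roots_barE f : map_poly iota f =
  (iota (lead_coef f))%:P * \prod_(a <- roots_bar iota f) ('X - a%:P).
Proof.
rewrite /roots_bar; case: closed_field_poly_normal => r /= {1}->.
by rewrite lead_coef_map mul_polyC.
Qed.

Lemma nu_roots f : nu f =
  val (lead_coef f) + \sum_(a <- roots_bar iota f) mu ('X - a%:P).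
Proof. by rewrite -hmu roots_barE vfunM mu_iota vfun_prod. Qed.

Lemma val_roots f b : val f.[b] =
  val (lead_coef f) + \sum_(a <- roots_bar iota f) mu (iota b - a)%:P.
Proof.
rewrite -mu_iota -horner_map roots_barE hornerM hornerC polyCM vfunM mu_iota.
congr (_ + _); rewrite horner_prod (rmorph_prod polyC) vfun_prod.
by apply: eq_bigr => a _; rewrite hornerXsubC.
Qed.

(** If every root is bounded, then b is eventually closer to eta than any root,
    and b and eta have the same distance to each root. *)
Lemma ev_bounded_eq f : (forall a, a \in roots_bar iota f -> ~ unbounded a) ->
  ev (fun b => val f.[b] = nu f).
Proof.
move=> bf; have h : ev (fun b => forall a, a \in roots_bar iota f ->
    mu ('X - a%:P) < gam b).
  by apply: eventually_all => a /bf; apply: bounded_ev.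
apply: eventually_mono (eventually_and h (ev_separated f)) => b [{}h sf].
rewrite nu_roots val_roots; congr (_ + _); apply: eq_big_seq => a ar.
by rewrite sf // min_r // ltW // h.
Qed.

(** As b approaches eta, the value of b - a decreases for no root a, and
    increases strictly for an unbounded one. *)
Lemma separated_lt f a b b' : f != 0 -> a \in roots_bar iota f ->
    unbounded a -> separated f b -> separated f b' -> gam b < gam b' ->
  val f.[b] < val f.[b'].
Proof.
move=> f0 ar ua sb sb' bb'.
have lf : val (lead_coef f) != Infty by rewrite val_eqInfty lead_coef_eq0.
have df a' : a' \in roots_bar iota f -> mu (iota b - a')%:P != Infty.
  move=> /sb ->; rewrite -vinf_ltInfty gt_min; apply/orP; left.
  by rewrite vinf_ltInfty approx_val_fin.
rewrite !val_roots vinf_ltD2l //; apply: (vinf_lt_sum (j := a)) => // [a' ar'|].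
  by rewrite sb // sb' // le_min !ge_min lexx ltW ?orbT.
by rewrite sb // sb' // !min_l.
Qed.

(** Around b the polynomial f splits into the factors X + (b - a), and
    v (b - a) <= v (eta - b); so the value of f in b is the
    least of the values of the terms of its Taylor expansion at b. *)
Lemma separated_taylor_ge f b l : separated f b ->
  val f.[b] <= val f^`N(l).[b] + gam b *+ l.
Proof.
move=> sf; rewrite val_roots -(coef_comp_polyXD f b) -(mu_iota (_`_l)).
rewrite -coef_map.
rewrite map_comp_poly rmorphD /= map_polyX map_polyC roots_barE.
rewrite comp_polyM comp_polyC coefCM polyCM vfunM mu_iota -addrA.
rewrite vinf_leD2l // rmorph_prod /=.
have -> : \prod_(a <- roots_bar iota f) (('X - a%:P) \Po ('X + (iota b)%:P)) =
    \prod_(t <- [seq iota b - a | a <- roots_bar iota f]) ('X + t%:P).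
  rewrite big_map; apply: eq_bigr => a _.
  by rewrite comp_polyB comp_polyX comp_polyC polyCB addrA.
have := @coef_prod_XD_le _ _ (vcomp polyC mu)
  [seq iota b - a | a <- roots_bar iota f] (gam b) l.
rewrite !big_map; apply=> _ /mapP[a /sf e ->]; rewrite /= e.
by rewrite ge_min lexx.
Qed.

End Roots.

(** * The minimal polynomial of the generator *)

Section Generator.
Variables (K : fieldType) (L : fieldExtType K) (eta : L).
Hypothesis eta_gen : <<1; eta>>%VS = fullv.
Local Notation n := (\dim {:L}).
Implicit Types f g : {poly K}.

Lemma adjoin_degree1 : adjoin_degree 1%AS eta = n.
Proof. by rewrite adjoin_degreeE dimv1 divn1 eta_gen. Qed.

Lemma minimal_polynomial_exists : exists g : {poly K},
  [/\ g \is monic, size g = n.+1, horner_alg eta g = 0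
    & forall f, (size f <= n)%N -> horner_alg eta f = 0 -> f = 0].
Proof.
have /polyOver1P[g gE] := minPolyOver 1%AS eta.
have sg : size g = n.+1.
  by rewrite -(size_map_poly (in_alg L)) -gE size_minPoly adjoin_degree1.
exists g; split=> //.
- by rewrite -(map_monic (in_alg L)) -gE monic_minPoly.
- by apply/eqP; have := root_minPoly 1%AS eta; rewrite gE.
move=> f sf f0; apply/eqP/negPn/negP => fN0.
have : minPoly 1%AS eta %| map_poly (in_alg L) f.
  by apply: minPoly_dvdp; [apply/polyOver1P; exists f | apply/eqP].
rewrite gE dvdp_map => /dvdp_leq; rewrite fN0 sg => /(_ isT).
by move=> /leq_trans /(_ sf); rewrite ltnn.
Qed.

Lemma generator_repr (z : L) :
  exists2 f : {poly K}, (size f <= n)%N & horner_alg eta f = z.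
Proof.
have /polyOver1P[f fE] := Fadjoin_polyOver 1%AS eta z.
exists f.
  by rewrite -(size_map_poly (in_alg L)) -fE -adjoin_degree1 size_poly.
have : z \in <<1%AS; eta>>%VS by rewrite /= eta_gen memvf.
by move=> /Fadjoin_poly_eq; rewrite fE.
Qed.

Lemma generator_dim_gt1 : (forall b : K, eta != b%:A) -> (1 < n)%N.
Proof.
move=> eta_notin; have [g [/monicP mg sg g0 _]] := minimal_polynomial_exists.
case: n sg => [|[|//]] sg.
  have c1 : g`_0 = 1 by rewrite -mg lead_coefE sg.
  have g1 : g = 1 by rewrite (size1_polyC (eq_leq sg)) c1.
  by move: g0; rewrite g1 rmorph1 => /eqP; rewrite oner_eq0.
suff gE : g = 'X + (g`_0)%:P.
  move: g0; rewrite gE rmorphD /= horner_algX horner_algC => /eqP.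
  rewrite addr_eq0 -scaleNr => /eqP e.
  by have := eta_notin (- g`_0); rewrite e eqxx.
apply/polyP => i; rewrite coefD coefX coefC.
case: i => [|[|i]] /=; rewrite ?add0r ?addr0 //.
  by rewrite -mg lead_coefE sg.
by rewrite nth_default ?sg.
Qed.

End Generator.

(** * Key polynomials of a pure extension *)

Section KeyPolynomials.
Variables (K : fieldType) (L : fieldExtType K) (G : orderedAbType).
Variables (v : valuation L G) (eta : L).
Variables (Kbar : closedFieldType) (iota : {rmorphism K -> Kbar}).
Variable mu : valuation {poly Kbar} G.
Hypothesis hmu : forall f : {poly K}, mu (map_poly iota f) = nu v eta f.
Hypothesis eta_notin : forall b : K, eta != b%:A.
Hypothesis hpure : pure_immediate v eta.

Local Notation gam := (approx_val v eta).
Local Notation ev := (eventually v eta).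
Local Notation nu := (nu v eta).
Local Notation val := (vbase v).
Local Notation n := (\dim {:L}).
Local Notation unbounded := (unbounded v eta mu).
Local Notation separated := (separated v eta iota mu).
Implicit Types (b c d : K) (f h F Q : {poly K}) (a : Kbar).

Lemma pure_approx_val_lt b : exists b', gam b < gam b'.
Proof. by case: hpure => _ im _; apply: immediate_approx_val_lt. Qed.

(** An unbounded root would make v (f b) increase strictly, whereas purity makes
    it constant. *)
Lemma pure_bounded f a : f != 0 -> (size f <= n)%N ->
  a \in roots_bar iota f -> ~ unbounded a.
Proof.
move=> f0 sf ar ua; have [_ _ /(_ f sf)[c fc]] := hpure.
have [b [cb sb]] : exists b, gam c <= gam b /\
    forall b', gam b <= gam b' -> separated f b'.
  apply: eventually_ex; apply: eventually_and (eventually_ge v eta c) _.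
  exact/eventually_shift/(ev_separated hmu pure_approx_val_lt).
have [b' bb'] := pure_approx_val_lt b.
have := separated_lt hmu eta_notin f0 ar ua
  (sb b (lexx _)) (sb b' (ltW bb')) bb'.
by rewrite !fc ?ltxx // (le_trans cb) // ltW.
Qed.

Lemma pure_ev f : (size f <= n)%N -> ev (fun b => val f.[b] = nu f).
Proof.
move=> sf; have [->|f0] := eqVneq f 0.
  by exists 0 => b _; rewrite horner0 !vfun0.
apply: (ev_bounded_eq hmu pure_approx_val_lt) => a; exact: pure_bounded.
Qed.

(** A description without [delta] of the key polynomials for Psi_1; see
    [key_polynomial_for1P]. *)
Definition approx_key F := [/\ F \is monic, size F = n.+1
  & exists2 a, a \in roots_bar iota F & unbounded a].

Lemma delta_XsubC b : delta iota mu ('X - b%:P) = gam b.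
Proof.
have [|[a] +-> _] := deltaP iota mu (_ : (1 < size ('X - b%:P)%R)%N).
  by rewrite size_XsubC.
by rewrite map_polyXsubC root_XsubC => /eqP ->; apply: mu_XsubC.
Qed.

(** Otherwise [delta Q] would be reached by a linear polynomial X - b, because
    [delta] of X - b is v (eta - b). *)
Lemma key_polynomial_unbounded Q : key_polynomial iota mu Q ->
  (2 < size Q)%N -> exists2 a, a \in roots_bar iota Q & unbounded a.
Proof.
move=> [_ sQ keyQ] sQ2; have [[a ar da] _] := deltaP iota mu sQ.
exists a; rewrite ?roots_barP // => b; rewrite leNgt; apply/negP => ab.
have := keyQ ('X - b%:P).
rewrite size_XsubC da delta_XsubC => /(_ isT (ltW ab)).
by rewrite leqNgt sQ2.
Qed.

(** If [delta f] is at least [delta F], then f inherits an unbounded root from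
    F, which is impossible in degree less than n. *)
Lemma approx_key_key F : approx_key F -> key_polynomial iota mu F.
Proof.
have n1 : (1 < n)%N by case: hpure => gen _ _; apply: generator_dim_gt1 gen _.
move=> [mF sF [a aF ua]]; have sF1 : (1 < size F)%N by rewrite sF ltnW.
split=> // f sf dFf; rewrite sF ltnNge; apply/negP => sfn.
have [[a' ar da'] _] := deltaP iota mu sf.
apply: (@pure_bounded f a' _ sfn); rewrite ?roots_barP //.
  by rewrite -size_poly_gt0 ltnW.
move=> b; rewrite -da'; apply: le_trans dFf; apply: le_trans (ua b) _.
by have [_] := deltaP iota mu sF1; apply; rewrite -roots_barP.
Qed.

(** The value of g is infinite, and so is that of one of its linear
    factors. *)
Lemma minimal_polynomial_approx_key g :
  g \is monic -> size g = n.+1 -> horner_alg eta g = 0 -> approx_key g.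
Proof.
move=> mg sg g0; split=> //.
have nuI : nu g = Infty by rewrite /Defs.nu /= g0 vfun0.
apply/not_exists2P => h.
suff : nu g != Infty by rewrite nuI.
rewrite (nu_roots hmu) vinf_add_neqInfty (monicP mg) val_eqInfty oner_eq0 /=.
apply: vinf_sum_neqInfty => a ar; apply/eqP => aI.
by case: (h a) => // -[] b; rewrite aI vinf_leInfty.
Qed.

Lemma key_polynomial_for1P F : key_polynomial_for iota mu 1 F <-> approx_key F.
Proof.
have [gen _ _] := hpure; have n1 := generator_dim_gt1 gen eta_notin.
have size_key Q : key_polynomial iota mu Q -> (2 < size Q)%N ->
    (n < size Q)%N.
  move=> keyQ sQ; have [a ar ua] := key_polynomial_unbounded keyQ sQ.
  rewrite ltnNge; apply/negP => /(pure_bounded _) /(_ ar); apply=> //.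
  by rewrite -size_poly_gt0 (ltn_trans _ sQ).
split=> [[keyF sF minF]|kF].
  split; [by case: keyF | | exact: key_polynomial_unbounded].
  apply/eqP; rewrite eqn_leq size_key // andbT.
  have [g [mg sg g0 _]] := minimal_polynomial_exists gen.
  rewrite -sg; apply: minF; rewrite ?sg //.
  exact/approx_key_key/minimal_polynomial_approx_key.
have [_ sF _] := kF; split; rewrite ?sF //; exact: approx_key_key.
Qed.

End KeyPolynomials.

(** * The exponent 1 of the minimal key polynomials *)

Section Exponents.
Variables (K : fieldType) (L : fieldExtType K) (G : orderedAbType).
Variables (v : valuation L G) (eta : L).
Variables (Kbar : closedFieldType) (iota : {rmorphism K -> Kbar}).
Variable mu : valuation {poly Kbar} G.
Hypothesis hmu : forall f : {poly K}, mu (map_poly iota f) = nu v eta f.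
Hypothesis eta_notin : forall b : K, eta != b%:A.
Hypothesis hpure : pure_immediate v eta.

Local Notation gam := (approx_val v eta).
Local Notation ev := (eventually v eta).
Local Notation nu := (nu v eta).
Local Notation val := (vbase v).
Local Notation n := (\dim {:L}).
Local Notation separated := (separated v eta iota mu).
Local Notation approx_key := (approx_key v eta iota mu).
Implicit Types (b c d : K) (f h F Q : {poly K}) (x : vinf G).

Let gam_lt := pure_approx_val_lt eta_notin hpure.
Let ev_eq := pure_ev hmu eta_notin hpure.

(** Because v (F d) increases for a key polynomial F, this means that x exceeds
    all the values of F close to eta. *)
Definition beyond F x := ev (fun d => val F.[d] < x).

Lemma beyond_le F x y : x <= y -> beyond F x -> beyond F y.
Proof. by move=> xy; apply: eventually_mono => d /lt_le_trans; apply. Qed.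

Lemma approx_key_ev_lt F : approx_key F ->
  ev (fun b => forall b', gam b < gam b' -> val F.[b] < val F.[b']).
Proof.
move=> [mF _ [a ar ua]].
apply: eventually_mono (eventually_shift (ev_separated hmu gam_lt F)) => b sF.
move=> b' bb'; have F0 := monic_neq0 mF.
exact: (separated_lt hmu eta_notin F0 ar ua (sF b (lexx _)) (sF b' (ltW bb'))).
Qed.

(** The values of a polynomial with bounded roots are eventually constant. *)
Lemma approx_key_of_ev_lt F : F \is monic -> size F = n.+1 ->
    ev (fun b => exists2 b', gam b < gam b' & val F.[b] < val F.[b']) ->
  approx_key F.
Proof.
move=> mF sF inc; split=> //; apply/not_exists2P => h.
have bF : ev (fun b => val F.[b] = nu F).
  by apply: (ev_bounded_eq hmu gam_lt) => a ar ua; case: (h a).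
have [b [[b' bb' lt] eq]] :=
  eventually_ex (eventually_and inc (eventually_shift bF)).
by move: lt; rewrite !eq ?ltxx // ltW.
Qed.

(** A perturbation h of degree less than n has an eventually constant value;
    F + h still climbs forever iff this value is never reached by F. *)
Lemma approx_keyD F h : approx_key F -> (size h <= n)%N ->
  approx_key (F + h) <-> beyond F (nu h).
Proof.
move=> kF sh; have incF := approx_key_ev_lt kF; have [mF sF _] := kF.
split=> [kFh|bF].
  have := eventually_and (approx_key_ev_lt kFh)
    (eventually_and incF (ev_eq sh)).
  move=> /eventually_shift; apply: eventually_mono => b hb.
  have [incb [incFb eqb]] := hb b (lexx _).
  rewrite ltNge; apply/negP => hF.
  have [b' bb'] := gam_lt b; have [b'' bb''] := gam_lt b'.
  have nuh c : gam b < gam c -> val (F + h).[c] = nu h.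
    move=> bc; have [_ [_ eqc]] := hb c (ltW bc).
    rewrite hornerD addrC vfunD_lt eqc //; apply: le_lt_trans hF _.
    exact: incFb.
  have [incb' _] := hb b' (ltW bb'); have := incb' _ bb''.
  by rewrite !nuh ?ltxx // (lt_trans bb').
apply: approx_key_of_ev_lt.
- by rewrite monicE lead_coefDl ?sF ?ltnS // -monicE.
- by rewrite size_polyDl ?sF ?ltnS.
have := eventually_and incF (eventually_and bF (ev_eq sh)).
move=> /eventually_shift; apply: eventually_mono => b hb.
have Fh c : gam b <= gam c -> val (F + h).[c] = val F.[c].
  by move=> /hb[_ [ltc eqc]]; rewrite hornerD vfunD_lt ?eqc.
have [b' bb'] := gam_lt b; exists b' => //.
by rewrite !Fh ?(ltW bb') //; have [incb _] := hb b (lexx _); apply: incb.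
Qed.

Lemma beyondD F h x : (size h <= n)%N -> beyond F (nu h) ->
  beyond F x <-> beyond (F + h) x.
Proof.
move=> sh bF; have e : ev (fun d => val (F + h).[d] = val F.[d]).
  apply: eventually_mono (eventually_and bF (ev_eq sh)) => d [lt eq].
  by rewrite hornerD vfunD_lt ?eq.
by split=> bx; apply: eventually_mono (eventually_and e bx) => d [->].
Qed.

(** In the limit, the linear Taylor term has at least the value of h. *)
Lemma nu_le_deriv h : (size h <= n)%N ->
  ev (fun b => nu h <= nu h^`() + gam b).
Proof.
move=> sh; have sh' : (size h^`() <= n)%N.
  by rewrite -nderivn1 (leq_trans (size_poly _ _)) // leq_subLR leqW.
have := eventually_and (ev_separated hmu gam_lt h)
  (eventually_and (ev_eq sh) (ev_eq sh')).
apply: eventually_mono => b [sb [eb eb']].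
by have := separated_taylor_ge hmu 1 sb; rewrite nderivn1 eb eb'.
Qed.

(** The value of the linear Taylor term of F at b, for b close to eta, exceeds
    all the values of F on K. *)
Definition derivative_negligible F :=
  exists b, beyond F (nu F^`() + gam b).

(** The linear Taylor term of h is at least as large, in value, as h, which is
    itself beyond the values of F; so it affects neither side. *)
Lemma derivative_negligibleD F h : (size h <= n)%N -> beyond F (nu h) ->
  derivative_negligible F -> derivative_negligible (F + h).
Proof.
move=> sh bF [b1 h1].
have [b [b1b hb]] := eventually_ex
  (eventually_and (eventually_ge v eta b1) (nu_le_deriv sh)).
exists b; rewrite -beyondD // derivD.
have bF1 : beyond F (nu F^`() + gam b).
  by apply: beyond_le h1; apply: vinf_leD.
have bh1 := beyond_le hb bF.
apply: eventually_mono (eventually_and bF1 bh1) => d [dF dh].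
exact: vfunD_ltD dF dh.
Qed.

Lemma approx_key_subr F F' : approx_key F -> approx_key F' ->
  (size (F' - F)%R <= n)%N /\ beyond F (nu (F' - F)).
Proof.
move=> kF kF'; have [mF sF _] := kF; have [mF' sF' _] := kF'.
have s : (size (F' - F)%R <= n)%N.
  apply/leq_sizeP => j; rewrite leq_eqVlt coefB => /predU1P[<-|nj].
    move: mF mF'; rewrite !monicE !lead_coefE sF sF' /= => /eqP-> /eqP->.
    by rewrite subrr.
  by rewrite !nth_default ?subrr ?sF ?sF'.
by split=> //; apply/approx_keyD; rewrite // addrC subrK.
Qed.

Lemma derivative_negligible_key F F' : approx_key F -> approx_key F' ->
  derivative_negligible F -> derivative_negligible F'.
Proof.
move=> kF kF'; have [s bF] := approx_key_subr kF kF'.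
by move=> /(derivative_negligibleD s bF); rewrite addrC subrK.
Qed.

Lemma Psi1_XsubC b : Psi iota mu 1 ('X - b%:P).
Proof.
split; last by rewrite size_XsubC.
by split; rewrite ?monicXsubC ?size_XsubC.
Qed.

Lemma Psi1P Q : Psi iota mu 1 Q -> exists b, Q = 'X - b%:P.
Proof.
move=> [[mQ _ _] sQ]; exists (- Q`_0); apply/polyP => i.
rewrite polyCN opprK coefD coefX coefC.
case: i => [|[|i]] /=; rewrite ?add0r ?addr0 //.
  by move: mQ; rewrite monicE lead_coefE sQ => /eqP.
by rewrite nth_default ?sQ.
Qed.

(** Cofinal subsets of Psi_1 contain X - b with b as close to eta as needed. *)
Lemma cofinal_ev (C : set {poly K}) P :
    cofinal nu C (Psi iota mu 1) -> ev P ->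
  exists2 b, C ('X - b%:P) & P b.
Proof.
move=> [C1 cofC] [b0 h]; have [R CR] := cofC _ (Psi1_XsubC b0).
have [b e] := Psi1P (C1 _ CR); rewrite e in CR *.
by rewrite !nu_XsubC => /h; exists b.
Qed.

(** The values of the Taylor terms are eventually affine functions of
    v (eta - b) with distinct slopes k, so two of them agree for at most one
    value of v (eta - b). *)
Lemma ev_taylor_distinct F : size F = n.+1 ->
  ev (fun b => {in index_iota 1 (size F) &, forall k l, k != l ->
    nu ((F^`N(k).[b])%:P * ('X - b%:P) ^+ k) != Infty ->
    nu ((F^`N(k).[b])%:P * ('X - b%:P) ^+ k) !=
      nu ((F^`N(l).[b])%:P * ('X - b%:P) ^+ l)}).
Proof.
move=> sF; pose s := index_iota 1 (size F).
have sN l : l \in s -> (size F^`N(l) <= n)%N.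
  rewrite mem_index_iota => /andP[l0 _].
  by rewrite (leq_trans (size_poly _ _)) // sF leq_subLR -add1n leq_add2r.
have evN : ev (fun b => forall l, l \in s -> val F^`N(l).[b] = nu F^`N(l)).
  by apply: eventually_all => l ls; apply: ev_eq (sN l ls).
have distinct k l : ev (fun b => k != l -> nu F^`N(k) != Infty ->
    nu F^`N(k) + gam b *+ k != nu F^`N(l) + gam b *+ l).
  have [[z [kl kf ez]]|h] := pselect (exists z, [/\ k != l,
      nu F^`N(k) != Infty & nu F^`N(k) + gam z *+ k = nu F^`N(l) + gam z *+ l]).
    have [z' zz'] := gam_lt z; exists z' => b z'b _ _.
    by apply: vinf_affine_neq ez; rewrite ?approx_val_fin // (lt_le_trans zz').
  by exists 0 => b _ kl kf; apply/eqP => e; apply: h; exists b.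
have evD : ev (fun b => forall k, k \in s -> forall l, l \in s -> k != l ->
    nu F^`N(k) != Infty ->
    nu F^`N(k) + gam b *+ k != nu F^`N(l) + gam b *+ l).
  by apply: eventually_all => k _; apply: eventually_all => l _.
apply: eventually_mono (eventually_and evN evD) => b [{}evN {}evD] k l ks ls kl.
rewrite !vfunM !nuC !vfunX !nu_XsubC !evN //.
rewrite vinf_add_neqInfty => /andP[kf _]; exact: evD.
Qed.

Section Minimal.
Variables (Q1 : set {poly K}) (F : {poly K}) (B : set nat).
Hypothesis Q1_cof : cofinal nu Q1 (Psi iota mu 1).
Hypothesis hFB : exponents_of_minimal iota mu nu Q1 F B.

Let keyP := key_polynomial_for1P hmu eta_notin hpure.

Lemma minimal_approx_key : approx_key F.
Proof. by apply/keyP; case: hFB. Qed.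

Lemma cofinal_trans1 C : cofinal nu C Q1 -> cofinal nu C (Psi iota mu 1).
Proof.
move=> [CQ cofC]; have [QP cofQ] := Q1_cof; split=> [P /CQ /QP //|P /cofQ[R]].
by move=> /cofC[S CS RS] PR; exists S => //; apply: le_trans RS.
Qed.

(** The truncation to B and the one to B without 1 differ by the linear Taylor
    term; if this term is beyond the values of F, removing it still leaves a
    key polynomial. *)
Lemma not_negligible_of_in1_exponents : B 1%N -> ~ derivative_negligible F.
Proof.
have kF := minimal_approx_key; have [mF sF _] := kF.
have n1 : (1 < n)%N by case: hpure => gen _ _; apply: generator_dim_gt1 gen _.
have [_ _ [Q Q1Q [keyB remB]]] := hFB => B1 [b1 hb1].
have [C cofC notkey] := remB _ B1.
have [q Qq] := Psi1P (Q1_cof.1 _ Q1Q).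
have sF' : (size F^`() <= n)%N.
  by rewrite -nderivn1 (leq_trans (size_poly _ _)) // sF subn1.
have := eventually_and (eventually_ge v eta b1)
  (eventually_and (eventually_ge v eta q) (ev_eq sF')).
move=> /(cofinal_ev (cofinal_trans1 cofC))[b Cb [b1b [qb eb]]].
apply: (notkey _ Cb); apply/keyP.
have sF1 : (0 < 1 < size F)%N by rewrite sF; apply: ltnW n1.
rewrite (expansion_restr_remove _ B1 sF1) nderivn1 expr1.
have kR : approx_key (expansion_restr F ('X - b%:P) B).
  by apply/keyP/keyB; [exact: cofC.1 | rewrite Qq !nu_XsubC].
have [sR bR] := approx_key_subr kF kR.
apply/(approx_keyD kR).
  rewrite size_polyN mul_polyC (leq_trans (size_scale_leq _ _)) //.
  by rewrite size_XsubC.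
have := (beyondD (nu (- ((F^`()).[b]%:P * ('X - b%:P)))) sR bR).1.
rewrite [F + _]addrC subrK; apply.
apply: beyond_le hb1; rewrite vfunN vfunM nuC nu_XsubC eb.
exact: vinf_leD2l.
Qed.

(** The Taylor terms left out, among them the linear one, have a sum beyond the
    values of F; as the values of the terms are distinct, the linear term alone
    is then beyond the values of F. *)
Lemma negligible_of_notin1_exponents : ~ B 1%N -> derivative_negligible F.
Proof.
have kF := minimal_approx_key; have [mF sF _] := kF.
have n1 : (1 < n)%N by case: hpure => gen _ _; apply: generator_dim_gt1 gen _.
have [_ _ [Q Q1Q [keyB _]]] := hFB => B1.
have [q Qq] := Psi1P (Q1_cof.1 _ Q1Q).
have sF' : (size F^`() <= n)%N.
  by rewrite -nderivn1 (leq_trans (size_poly _ _)) // sF subn1.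
have := eventually_and (ev_taylor_distinct sF)
  (eventually_and (eventually_ge v eta q) (ev_eq sF')).
move=> /(cofinal_ev Q1_cof)[b Q1b [dis [qb eb]]].
have kR : approx_key (expansion_restr F ('X - b%:P) B).
  by apply/keyP/keyB; rewrite // Qq !nu_XsubC.
have [_ bR] := approx_key_subr kF kR; exists b; apply: beyond_le bR.
rewrite {2}(expansion_restr_compl b B (_ : (0 < size F)%N)) ?sF //.
rewrite opprD addrA subrr add0r vfunN -big_filter -sF.
set s := filter _ _; pose E l := (F^`N(l).[b])%:P * ('X - b%:P) ^+ l.
have := @vfun_sum_le _ _ nu _ s E.
rewrite filter_uniq ?iota_uniq // => /(_ isT _ 1%N).
rewrite /E nderivn1 expr1 vfunM nuC nu_XsubC eb; apply.
  move=> k l; rewrite !mem_filter => /andP[_ ks] /andP[_ ls].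
  exact: dis ks ls.
rewrite mem_filter mem_index_iota sF; apply/andP; split; first exact/asboolP.
exact: ltnW n1.
Qed.

End Minimal.

End Exponents.

(** * Vanishing of Kähler differentials *)

Section KahlerCriteria.
Variables (R A : comNzRingType) (f : {rmorphism R -> A}).

Lemma kahler_d_eq0 a : kahler_d f a = 0 -> kahler_span f << a >>.
Proof.
move=> /eqP.
rewrite /kahler_d -(raddf0 (\pi_(Quotient.quot (kahler_sub f))%qT)).
by rewrite -Quotient.idealrBE subr0 => /asboolP.
Qed.

Lemma kahler_eq0 : (forall a, kahler_d f a = 0) -> forall w : kahler f, w = 0.
Proof.
move=> d0 w; rewrite (kahler_repr w).
rewrite -(raddf0 (\pi_(Quotient.quot (kahler_sub f))%qT)).
apply: kahler_pi_eq; rewrite subr0 -(freeg_sumE (repr w)).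
apply: (big_ind (kahler_span f)); first exact: Kahler_span0.
  exact: kahler_spanDD.
move=> a _; have := kahler_spanZ (coeff a (repr w)) (kahler_d_eq0 (d0 a)).
by rewrite -[_ *: _]/(fgscale _ _) /fgscale domU1 big_seq1 coeffU eqxx !mulr1.
Qed.

(** Derivations into the quotient of M by I, without forming this quotient: a
    map to M that satisfies the rules of a derivation modulo the submodule I
    vanishes modulo I where the universal derivation vanishes. *)
Lemma kahler_d_eq0_derivation (M : lmodType A) (I : M -> Prop) (D : A -> M) :
    I 0 -> (forall x y, I x -> I y -> I (x + y)) ->
    (forall a x, I x -> I (a *: x)) ->
    (forall a b, I (D (a + b) - D a - D b)) ->
    (forall a b, I (D (a * b) - a *: D b - b *: D a)) ->
    (forall r, I (D (f r))) ->
  forall a, kahler_d f a = 0 -> I (D a).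
Proof.
move=> I0 ID IZ DD DM Dc a /kahler_d_eq0.
pose h : {freeg A / A} -> M := fglift D.
have hB x y : h (x - y) = h x - h y by apply: lift_is_additive.
have h0 : h 0 = 0 by rewrite -(subrr 0) hB subrr.
have hD x y : h (x + y) = h x + h y.
  by rewrite -[y in LHS]opprK hB -[- y]sub0r hB h0 sub0r opprK.
have h1 b : h << b >> = D b by rewrite /h liftU scale1r.
have hZ b x : h (b *: x) = b *: h x.
  have hs (r : seq A) (E : A -> {freeg A / A}) :
    h (\sum_(i <- r) E i) = \sum_(i <- r) h (E i) := big_morph h hD h0 _ _ _.
  have -> : h x = \sum_(z <- dom x) coeff z x *: D z.
    by rewrite -{1}(freeg_sumE x) hs; apply: eq_bigr => z _; rewrite /h liftU.
  rewrite -[b *: x]/(fgscale b x) /fgscale hs scaler_sumr.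
  by apply: eq_bigr => z _; rewrite /h liftU scalerA.
rewrite -h1; elim=> [|b x y rx _ Iy]; first by rewrite h0.
rewrite hD hZ; apply: ID Iy; apply: IZ.
by case: rx => [c d|c d|r]; rewrite ?hB ?hZ !h1.
Qed.

End KahlerCriteria.

Section AmbientModule.
Variables (R : comNzRingType) (G : orderedAbType) (v : valuation R G).

(** A copy of R that carries the action of the valuation ring by
    multiplication. *)
Definition ambient (_ : valuation R G) : Type := R.
Local Notation M := (ambient v).
HB.instance Definition _ := GRing.Zmodule.copy M R.

Definition ambient_scale (a : vring v) (x : M) : M := val a * (x : R).

Lemma ambient_scaleA a b x :
  ambient_scale a (ambient_scale b x) = ambient_scale (a * b) x.
Proof. by rewrite /ambient_scale rmorphM mulrA. Qed.

Lemma ambient_scale1 : left_id 1 ambient_scale.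
Proof. by move=> x; rewrite /ambient_scale rmorph1 mul1r. Qed.

Lemma ambient_scaleDr : right_distributive ambient_scale +%R.
Proof. by move=> a x y; apply: mulrDr. Qed.

Lemma ambient_scaleDl x : {morph ambient_scale^~ x : a b / a + b}.
Proof. by move=> a b; rewrite /ambient_scale rmorphD; apply: mulrDl. Qed.

HB.instance Definition _ := GRing.Zmodule_isLmodule.Build (vring v) M
  ambient_scaleA ambient_scale1 ambient_scaleDr ambient_scaleDl.

End AmbientModule.

(** * Differentials of a pure extension *)

Section Differentials.
Variables (K : fieldType) (L : fieldExtType K) (G : orderedAbType).
Variables (v : valuation L G) (eta : L).
Variables (Kbar : closedFieldType) (iota : {rmorphism K -> Kbar}).
Variable mu : valuation {poly Kbar} G.
Hypothesis hmu : forall f : {poly K}, mu (map_poly iota f) = nu v eta f.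
Hypothesis eta_notin : forall b : K, eta != b%:A.
Hypothesis hpure : pure_immediate v eta.
Variable g : {poly K}.
Hypothesis kg : approx_key v eta iota mu g.
Hypothesis g0 : horner_alg eta g = 0.
Hypothesis g_min : forall f : {poly K},
  (size f <= \dim {:L})%N -> horner_alg eta f = 0 -> f = 0.

Local Notation gam := (approx_val v eta).
Local Notation ev := (eventually v eta).
Local Notation nu := (nu v eta).
Local Notation val_ := (vbase v).
Local Notation n := (\dim {:L}).
Local Notation dv := (kahler_d (@vring_map _ _ _ (in_alg L) v)).
Local Notation cst := (@vring_map _ _ _ (in_alg L) v).
Implicit Types (b c d : K) (f h p q : {poly K}) (y z w : vring v).

Let gam_lt := pure_approx_val_lt eta_notin hpure.
Let ev_eq := pure_ev hmu eta_notin hpure.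

(** The chain rule d (p y) = p' (y) dy for a polynomial p over the valuation
    ring of K. It is stated for p over K with integral coefficients since the
    polynomials of interest arise by rescaling polynomials over K. *)
Lemma polynomial_differential p y : p \is a polyOver (vring_pred val_) ->
  exists z w, [/\ val z = horner_alg (val y) p,
    val w = horner_alg (val y) p^`() & dv z = w *: dv y].
Proof.
elim/poly_ind: p => [|q c IH] /polyOverP pK.
  exists 0, 0; rewrite deriv0 !rmorph0; split=> //.
  by rewrite scale0r -[0 : vring v](rmorph0 cst) kahler_d_cst.
have /IH[z [w [zq wq dz]]] : q \is a polyOver (vring_pred val_).
  by apply/polyOverP => i; have := pK i.+1; rewrite coefD coefMX coefC addr0.
have cK : c \in vring_pred val_.
  by have := pK 0%N; rewrite coefD coefMX coefC add0r.
exists (z * y + cst (VRing cK)), (w * y + z); split.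
- by rewrite rmorphD rmorphM /= zq rmorphD rmorphM /= horner_algX horner_algC.
- rewrite derivD derivM derivX derivC addr0 mulr1 rmorphD rmorphM /= zq wq.
  by rewrite rmorphD rmorphM /= horner_algX.
by rewrite kahler_dD kahler_d_cst addr0 kahler_dM dz scalerA [y * w]mulrC
  -scalerDl addrC.
Qed.

(** With v c = v (eta - b), the polynomial that takes in (eta - b) / c the value
    of f in eta. *)
Definition dilate f b c := f \Po (c *: 'X + b%:P).

Lemma coef_dilate f b c l : (dilate f b c)`_l = f^`N(l).[b] * c ^+ l.
Proof.
have -> : dilate f b c = (f \Po ('X + b%:P)) \Po (c *: 'X).
  by rewrite -comp_polyA comp_polyD comp_polyX comp_polyC.
rewrite -coef_comp_polyXD; move: (f \Po ('X + b%:P)) => p.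
rewrite comp_polyE coef_sum.
under eq_bigr => i _ do rewrite exprZn coefZ coefZ coefXn.
have [lp|pl] := ltnP l (size p).
  rewrite (bigD1 (Ordinal lp)) //= eqxx mulr1 big1 ?addr0 // => i il.
  by rewrite eq_sym [_ == _](negbTE il) !mulr0.
rewrite nth_default // mul0r big1 // => i _.
by rewrite gtn_eqF ?mulr0 // (leq_trans (ltn_ord i)).
Qed.

Lemma horner_alg_comp x f h :
  horner_alg x (f \Po h) = horner_alg (horner_alg x h : L) f.
Proof.
by rewrite /= /horner_alg /horner_morph /= map_comp_poly horner_comp.
Qed.

Lemma dilated_root b c : c != 0 -> val_ c = gam b ->
  exists2 y : vring v, val y * c%:A = eta - b%:A &
    forall f, horner_alg (val y) (dilate f b c) = horner_alg eta f.
Proof.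
move=> c0 cb; have cA0 : c%:A != 0 :> L by rewrite scaler_eq0 oner_eq0 orbF.
have yP : (eta - b%:A) / c%:A \in vring_pred v.
  by rewrite inE vfun_div_ge0 // -/(gam b) -cb.
have [y yE] : exists y : vring v, val y * c%:A = eta - b%:A.
  by exists (VRing yP); rewrite /= divfK.
exists y => // f; rewrite horner_alg_comp; congr (horner_alg _ f).
rewrite rmorphD /= linearZ /= horner_algX horner_algC mulrC.
by rewrite yE subrK.
Qed.

Lemma cst_div c d : c != 0 -> val_ c <= val_ d -> d / c \in vring_pred val_.
Proof. by move=> c0 cd; rewrite inE vfun_div_ge0. Qed.

Lemma coef_dilate_ge f b c :
    separated v eta iota mu f b -> val_ c = gam b ->
  forall l, val_ f.[b] <= val_ (dilate f b c)`_l.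
Proof.
move=> sf cb l; rewrite coef_dilate vfunM vfunX cb.
exact: (separated_taylor_ge hmu l sf).
Qed.

(** Let y_d = (eta - d) / e, with v e = v (eta - d), for d closer to eta than b.
    Dividing the dilation of g at d by g d makes it integral, and its
    differential at y_d reads w dy_d = 0 with w = (e / g d) g' (eta). On the
    other hand y is an affine function of y_d with slope e / c, whence
    dy = (e / c) dy_d. For d close to eta, non-negligibility says
    that w divides e / c. *)
Lemma kahler_d_dilated b y c : ~ derivative_negligible v eta g ->
    c != 0 -> val_ c = gam b -> val y * c%:A = eta - b%:A ->
  dv y = 0.
Proof.
move=> Nneg c0 cb yE.
have [d [bd sd ufin gd]] : exists d, [/\ gam b <= gam d,
    separated v eta iota mu g d, val_ g.[d] != Infty
    & nu g^`() + gam b <= val_ g.[d]].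
  apply: contrapT => h; apply: Nneg; exists b.
  have := eventually_and (eventually_ge v eta b) (eventually_and
    (ev_separated hmu gam_lt g)
    (approx_key_ev_lt hmu eta_notin hpure kg)).
  apply: eventually_mono => d [bd [sd incd]]; rewrite ltNge; apply/negP => gd.
  apply: h; exists d; split=> //; have [d' dd'] := gam_lt d.
  exact: vinf_lt_neqInfty (incd d' dd').
have im : immediate v by case: hpure.
have [e e0 ed] := immediate_dilation eta_notin d im.
have [yd ydE ydh] := dilated_root e0 ed.
have u0 : g.[d] != 0 by rewrite -(vfun_eqInfty val_).
have /(@polynomial_differential _ yd)[z [w [zE wE dz]]] :
    g.[d]^-1 *: dilate g d e \is a polyOver (vring_pred val_).
  apply/polyOverP => l.
  by rewrite coefZ mulrC cst_div // coef_dilate_ge.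
have z0 : z = 0.
  by apply: val_inj; rewrite zE linearZ /= ydh g0 mulr0.
have wdy : w *: dv yd = 0.
  by rewrite -dz z0 -[0 : vring v](rmorph0 cst) kahler_d_cst.
have {}wE : val w = (e / g.[d])%:A * horner_alg eta g^`().
  rewrite wE derivZ deriv_comp derivD derivZ derivX derivC addr0.
  rewrite linearZ /= rmorphM /= -/(dilate g^`() d e) ydh.
  rewrite -[e *: 1]/(e%:A) -[e%:A]mul_polyC mulr1 horner_algC.
  rewrite -[(e / _)%:A]/(in_alg L _) rmorphM /=.
  by rewrite mulrC -mulrA mulrC.
have sK : e / c \in vring_pred val_ by rewrite cst_div // ed cb.
have tK : (d - b) / c \in vring_pred val_.
  rewrite cst_div // cb /vbase /=.
  have -> : (d - b)%:A = (eta - b%:A) - (eta - d%:A) :> L.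
    by rewrite scalerBl opprB [RHS]addrC subrKA.
  by apply: le_trans (vfunB_ge _ _ _); rewrite le_min lexx.
have cA0 : c%:A != 0 :> L by rewrite scaler_eq0 oner_eq0 orbF.
have divA x : (x / c)%:A * c%:A = x%:A :> L.
  by rewrite -![_%:A]/(in_alg L _) -rmorphM divfK.
have yy : y = cst (VRing sK) * yd + cst (VRing tK).
  apply: val_inj; apply: (mulIf cA0); rewrite yE rmorphD rmorphM /=.
  by rewrite mulrDl mulrAC !divA mulrC ydE scalerBl addrA subrK.
have -> : dv y = cst (VRing sK) *: dv yd.
  by rewrite yy kahler_dD kahler_dM !kahler_d_cst scaler0 !addr0.
have g'f : nu g^`() + gam b != Infty.
  by rewrite -vinf_ltInfty (le_lt_trans gd) // vinf_ltInfty.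
have [g'0 _] : nu g^`() != Infty /\ gam b != Infty.
  by apply/andP; rewrite -vinf_add_neqInfty.
have w0 : val w != 0.
  rewrite wE mulf_neq0 ?scaler_eq0 ?oner_eq0 ?orbF ?mulf_neq0 ?invr_eq0 //.
  by rewrite -(vfun_eqInfty v).
have mP : (e / c)%:A / val w \in vring_pred v.
  rewrite inE vfun_div_ge0 //.
  have cf : val_ c != Infty by rewrite cb approx_val_fin.
  rewrite -(vinf_leD2lE _ _ cf) -(vinf_leD2lE _ _ ufin).
  have xE x : x != 0 -> val_ x + val_ (e / x) = val_ e.
    by move=> x0; rewrite -vfunM mulrC divfK.
  rewrite wE vfunM -[v (e / g.[d])%:A]/(val_ _) -[v (e / c)%:A]/(val_ _) xE //.
  rewrite addrCA [val_ g.[d] + (_ + _)]addrA xE // addrCA [leRHS]addrC.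
  by rewrite vinf_leD2l // addrC cb.
have -> : cst (VRing sK) = VRing mP * w.
  by apply: val_inj; rewrite /= divfK.
by rewrite -scalerA wdy scaler0.
Qed.

(** Close to eta, an element of the valuation ring is an integral polynomial in
    some dilated generator, whose differential vanishes. *)
Lemma Omega_eq0 : ~ derivative_negligible v eta g ->
  forall w : Omega v, w = 0.
Proof.
move=> Nneg; apply: kahler_eq0 => a; have [gen _ _] := hpure.
have [f sf fa] := generator_repr gen (val a).
have [b [sb eb]] := eventually_ex
  (eventually_and (ev_separated hmu gam_lt f) (ev_eq sf)).
have im : immediate v by case: hpure.
have [c c0 cb] := immediate_dilation eta_notin b im.
have [y yE yh] := dilated_root c0 cb.
have /(@polynomial_differential _ y)[z [w [zE _ dz]]] :
    dilate f b c \is a polyOver (vring_pred val_).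
  apply/polyOverP => l; rewrite inE.
  apply: le_trans (coef_dilate_ge sb cb l); rewrite eb /Defs.nu /= fa.
  exact: vring_valP.
have -> : a = z by apply: val_inj; rewrite zE yh fa.
by rewrite dz (kahler_d_dilated Nneg c0 cb yE) scaler0.
Qed.

(** The product of two representatives has to be reduced to its remainder modulo
    g, so f |-> f' (eta) fails the Leibniz rule by q (eta) g' (eta), where q is
    the quotient. As q g takes integral values close to eta, v (q eta) is at
    least - v (g d), and by negligibility the error term has a value above
    - v (eta - b0). The dilated generator (eta - b0) / c has derivative 1 / c,
    of value exactly - v (eta - b0). *)
Lemma Omega_neq0 : derivative_negligible v eta g ->
  ~ (forall w : Omega v, w = 0).
Proof.
move=> [b0 gb0] Om0; have [gen _ _] := hpure; have [mg sg _] := kg.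
have [rep repP] : {rep : vring v -> {poly K} & forall z,
    (size (rep z) <= n)%N /\ horner_alg eta (rep z) = val z}.
  apply: (@choice (vring v) {poly K}
    (fun z f => (size f <= n)%N /\ horner_alg eta f = val z)).
  by move=> z; have [f] := generator_repr gen (val z); exists f.
have repE z f : (size f <= n)%N -> horner_alg eta f = val z -> rep z = f.
  have [sz hz] := repP z => sf hf; apply/eqP; rewrite -subr_eq0; apply/eqP.
  apply: g_min; last by rewrite rmorphB /= hz hf subrr.
  by rewrite (leq_trans (size_polyD _ _)) // size_polyN geq_max sz.
pose D z : ambient v := horner_alg eta (rep z)^`().
(* I is the submodule of the x with v x > - v (eta - b0). *)
pose I (x : ambient v) := Fin 0 < v x + gam b0.
have I0 : I 0 by rewrite /I vfun0.
have ID (x t : ambient v) : I x -> I t -> I (x + t) by apply: vfunD_ltD.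
have IZ (a : vring v) (x : ambient v) : I x -> I (a *: x).
  rewrite /I => Ix; rewrite [v _](vfunM v (val a) x) -addrA.
  apply: lt_le_trans Ix _; rewrite -[leLHS]add0r vinf_leD //.
  exact: vring_valP.
have im : immediate v by case: hpure.
have [c c0 cb] := immediate_dilation eta_notin b0 im.
have [y yE _] := dilated_root c0 cb.
have yrep : rep y = c^-1 *: ('X - b0%:P).
  apply: repE.
    rewrite (leq_trans (size_scale_leq _ _)) // size_XsubC.
    exact: (generator_dim_gt1 gen eta_notin).
  rewrite linearZ /= rmorphB /= horner_algX horner_algC -yE mulrC -mulrA.
  by rewrite -![_%:A]/(in_alg L _) -rmorphM mulfV // rmorph1 mulr1.
suff : I (D y).
  rewrite /D yrep derivZ derivB derivX derivC subr0 linearZ /= rmorph1.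
  rewrite mulr1 /I -cb -[v _]/(val_ _) -vfunM mulVf // vfun1.
  by rewrite ltxx.
apply: (@kahler_d_eq0_derivation _ _ cst (ambient v) I D) => //.
- move=> a b; have [sa ha] := repP a; have [sb hb] := repP b.
  rewrite /D; have -> : rep (a + b) = rep a + rep b.
    apply: repE; last by rewrite !rmorphD /= ha hb.
    by rewrite (leq_trans (size_polyD _ _)) // geq_max sa.
  by rewrite derivD rmorphD /= [X in X - _]addrC addKr subrr.
- move=> a b; have [sa ha] := repP a; have [sb hb] := repP b.
  pose q := (rep a * rep b) %/ g; pose r := (rep a * rep b) %% g.
  have qr : rep a * rep b = q * g + r by apply: divp_eq.
  have sr : (size r <= n)%N.
    by rewrite -ltnS -sg ltn_modp -size_poly_eq0 sg.
  have sq : (size q <= n)%N.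
    rewrite size_divp -?size_poly_eq0 sg // leq_subLR.
    rewrite (leq_trans (size_polyMleq _ _)) //.
    by rewrite (leq_trans (leq_pred _)) // leq_add.
  have abr : rep (a * b) = r.
    apply: repE => //; have -> : val (a * b) = val a * val b by [].
    rewrite -ha -hb -rmorphM qr rmorphD rmorphM /=.
    by rewrite g0 mulr0 add0r.
  have Dab : D (a * b) - a *: D b - b *: D a =
      - (horner_alg eta q * horner_alg eta g^`()).
    have := congr1 (fun p => horner_alg eta p^`()) qr.
    rewrite derivD !derivM !rmorphD !rmorphM /= g0 mulr0 add0r ha hb => e.
    rewrite /D abr -addrA -opprD.
    have -> : a *: D b + b *: D a =
        horner_alg eta (rep a)^`() * val b + val a * horner_alg eta (rep b)^`().
      by rewrite addrC; congr (_ + _); apply: mulrC.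
    by rewrite e opprD addrCA subrr addr0.
  rewrite Dab /I vfunN vfunM -addrA.
  have ev_abr := eventually_and (ev_eq sa)
    (eventually_and (ev_eq sb) (ev_eq sr)).
  have [d [gd [qd [ea [eb er]]]]] := eventually_ex
    (eventually_and gb0 (eventually_and (ev_eq sq) ev_abr)).
  have nonneg z : Fin 0 <= nu (rep z).
    by rewrite /Defs.nu /= (repP z).2; apply: vring_valP.
  (* q g is the product of the representatives minus that of the product. *)
  have : Fin 0 <= val_ (q * g).[d].
    have -> : q * g = rep a * rep b - r by rewrite qr addrK.
    rewrite hornerD hornerN hornerM; apply: le_trans (vfunB_ge _ _ _).
    rewrite le_min vfunM ea eb er -abr nonneg andbT.
    by rewrite vinf_addr_ge0.
  rewrite hornerM vfunM qd => qg.
  have [qI|qf] := eqVneq (nu q) Infty.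
    by rewrite -[v (horner_alg eta q)]/(nu q) qI.
  by apply: le_lt_trans qg _; rewrite vinf_ltD2l.
- move=> r; rewrite /I /D (repE _ (val r)%:P).
  + by rewrite derivC rmorph0 vfun0.
  + rewrite size_polyC (leq_trans (leq_b1 _)) //.
    exact: (ltnW (generator_dim_gt1 gen eta_notin)).
  + by rewrite horner_algC.
Qed.

End Differentials.

Theorem proposition6p6
    (K : fieldType) (L : fieldExtType K) (G : orderedAbType)
    (v : valuation L G) (eta : L)
    (hpure : pure_defect v eta \/ branched_pure v eta)
    (Kbar : closedFieldType) (iota : {rmorphism K -> Kbar})
    (halg : forall z : Kbar, algebraicOver iota z)
    (mu : valuation {poly Kbar} G)
    (hmu : forall f : {poly K}, mu (map_poly iota f) = nu v eta f)
    (Q1 : set {poly K})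
    (hQ1_wo : well_ordered (nu v eta) Q1)
    (hQ1_cof : cofinal (nu v eta) Q1 (Psi iota mu 1))
    (F : {poly K}) (B : set nat)
    (hFB : exponents_of_minimal iota mu (nu v eta) Q1 F B) :
  (forall w : Omega v, w = 0) <-> B 1%N.
Proof.
have {}hpure : pure_immediate v eta by case: hpure => -[].
have eta_notin b : eta != b%:A.
  apply/eqP => etab; have [[[_ _ keyF] sF _] _ _] := hFB.
  have := keyF ('X - b%:P).
  rewrite (delta_XsubC hmu) etab /approx_val subrr vfun0 vinf_leInfty.
  by rewrite size_XsubC => /(_ isT isT); rewrite leqNgt sF.
have [gen _ _] := hpure.
have [g [mg sg g0 g_min]] := minimal_polynomial_exists gen.
have kg := minimal_polynomial_approx_key hmu mg sg g0.
have kF := minimal_approx_key hmu eta_notin hpure hFB.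
have negl_eq := derivative_negligible_key hmu eta_notin hpure.
split=> [Om0|B1].
  apply: contrapT => nB1.
  apply: (Omega_neq0 hmu eta_notin hpure kg g0 g_min) Om0.
  apply: (negl_eq _ _ kF kg).
  exact: (negligible_of_notin1_exponents hmu eta_notin hpure hQ1_cof hFB).
apply: (Omega_eq0 hmu eta_notin hpure kg g0) => /(negl_eq _ _ kg kF).
exact: (not_negligible_of_in1_exponents hmu eta_notin hpure hQ1_cof hFB).
Qed.
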